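(* Let $\mathcal{H}^{(3e)}$ and $\mathcal{H}^{(3o)}$ be the semi-infinite matrices with entries $$\mathcal{H}^{(3e)}_{m,n}=(-1)^{m+n}\frac{\Gamma(m+n+1/2)}{\sqrt{(2m)!\,(2n)!}},\qquad \mathcal{H}^{(3o)}_{m,n}=(-1)^{m+n}\frac{\Gamma(m+n+3/2)}{\sqrt{(2m+1)!\,(2n+1)!}},$$ for $m,n\in\mathbb{N}_0$. Then $\mathcal{H}^{(3e)}$ and $\mathcal{H}^{(3o)}$ determine unique self-adjoint operators $H^{(3e)}$ and $H^{(3o)}$ on $\ell^2(\mathbb{N}_0)$, which are unitarily equivalent, via unitary mappings $U_e$ and $U_o$ respectively, to the operator of multiplication by the function $h$ on $L^2((0,\infty),d\mu)$. Here $$h(x)=\sqrt{2\pi}\,e^{-x^{2}},\qquad \frac{d\mu}{dx}(x)=\frac{1}{\sqrt{\pi}}e^{-x^{2}},$$ while the unitary operators are given as $$U_e:\ell^2(\mathbb{N}_0)\to L^2((0,\infty),d\mu):\ e_n\mapsto\sqrt2\,\hat P_{2n},\qquad U_o:\ell^2(\mathbb{N}_0)\to L^2((0,\infty),d\mu):\ e_n\mapsto\sqrt2\,\hat P_{2n+1},$$ where $\hat P_n(x)=\frac{1}{\sqrt{2^n n!}}H_n(x)$ and $H_n$ are the Hermite polynomials.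
   Context: $\mathbb{N}_0=\{0,1,2,\dots\}$; $\{e_n\mid n\in\mathbb{N}_0\}$ is the standard basis of $\ell^2(\mathbb{N}_0)$. Hermite polynomials: $H_n(x)=(2x)^n\,{}_2F_0\!\left(-\tfrac n2,-\tfrac{n-1}{2};-\,\big|\,-\tfrac1{x^2}\right)=n!\sum_{j=0}^{\lfloor n/2\rfloor}\frac{(-1)^j(2x)^{n-2j}}{j!\,(n-2j)!}$. A real symmetric semi-infinite matrix $\mathcal{A}$ whose columns belong to $\ell^2(\mathbb{N}_0)$ is said to determine a unique self-adjoint operator $A$ on $\ell^2(\mathbb{N}_0)$ if $A_{\min}=A_{\max}=:A$. Here $A_{\min}$ is the closure of the operator $x\mapsto\mathcal{A}x$ (formal matrix product) with domain $\operatorname{span}\{e_n\mid n\in\mathbb{N}_0\}$, and $A_{\max}x=\mathcal{A}x$ with domain $\{x\in\ell^2(\mathbb{N}_0)\mid\mathcal{A}x\in\ell^2(\mathbb{N}_0)\}$. An operator $H$ is unitarily equivalent via a unitary $V$ to an operator $T$ if $VHV^{-1}=T$; the multiplication operator by $h$ acts as $\psi\mapsto h\psi$ on the domain of all $\psi\in L^2((0,\infty),d\mu)$ with $h\psi\in L^2((0,\infty),d\mu)$. *)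

(* Defs.v *)
(* MathComp-Analysis; [R : realType] is the field of real numbers, and
   [R[i]] (from real-closed) the field of complex numbers.  All Hilbert spaces
   are complex, with inner products linear in the first argument. *)
From HB Require Import structures.
From mathcomp Require Import all_boot all_order all_algebra.
From mathcomp Require Import all_classical all_reals all_analysis.
From mathcomp Require Import measurable_realfun complex.

Set Implicit Arguments.
Unset Strict Implicit.
Unset Printing Implicit Defensive.

Import Order.TTheory GRing.Theory Num.Theory.
Import numFieldNormedType.Exports.
Import Normc.

Local Open Scope classical_set_scope.
Local Open Scope ring_scope.
Local Open Scope complex_scope.

Section ell2.
Variable R : realType.
Local Notation C := R[i].

Definition cseries (u : nat -> C) : C :=
  (limn (series (fun n => complex.Re (u n))))
  +i* (limn (series (fun n => complex.Im (u n)))).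

Definition ell2 : set (nat -> C) :=
  [set x | cvgn (series (fun n => normc (x n) ^+ 2))].

Definition ell2_inner (x y : nat -> C) : C :=
  cseries (fun n => x n * (y n)^*).

Definition ell2_norm (x : nat -> C) : R :=
  Num.sqrt (limn (series (fun n => normc (x n) ^+ 2))).

Definition ebasis (n : nat) : nat -> C := fun i => (i == n)%:R.

Definition span_ebasis : set (nat -> C) :=
  [set x | exists (N : nat) (c : 'I_N -> C),
             x = fun i => \sum_(k < N) c k * ebasis k i].

(* A possibly unbounded operator is represented by its graph, so equality of
   operators includes equality of their domains. *)
Definition ell2_operator := set ((nat -> C) * (nat -> C)).

Definition op_closure (T : ell2_operator) : ell2_operator :=
  [set p | [/\ ell2 p.1, ell2 p.2 &
    exists u v : nat -> (nat -> C),
      [/\ forall k, T (u k, v k),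
          ell2_norm (u k \- p.1) @[k --> \oo] --> (0 : R) &
          ell2_norm (v k \- p.2) @[k --> \oo] --> (0 : R)]]].

Definition mat_apply (M : nat -> nat -> R) (x : nat -> C) : nat -> C :=
  fun m => cseries (fun n => (M m n)%:C * x n).

Definition A_min (M : nat -> nat -> R) : ell2_operator :=
  op_closure [set p | span_ebasis p.1 /\ p.2 = mat_apply M p.1].

Definition A_max (M : nat -> nat -> R) : ell2_operator :=
  [set p | [/\ ell2 p.1, ell2 p.2 & p.2 = mat_apply M p.1]].

(* The first two clauses are what makes A_min and A_max meaningful: in particular
   the rows of M are square summable, so the series defining [mat_apply M x]
   converges for every x in l^2.  The operator so determined is [A_max M]. *)
Definition determines_unique_selfadjoint (M : nat -> nat -> R) : Prop :=
  [/\ forall m n, M m n = M n m,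
      forall n, ell2 (fun m => (M m n)%:C) &
      A_min M = A_max M].

End ell2.

(* Elements of L^2(D, mu) are represented by functions, of which only the values
   on D matter, and which are identified by [L2_eq]. *)
Section L2.
Context {R : realType} {d : measure_display} {T : measurableType d}.
Variables (mu : {measure set T -> \bar R}) (D : set T).
Local Notation C := R[i].

Definition L2 : set (T -> C) :=
  [set f : T -> C | [/\ measurable_fun D (fun x => complex.Re (f x) : R),
               measurable_fun D (fun x => complex.Im (f x) : R) &
               (\int[mu]_(x in D) ((normc (f x)) ^+ 2)%:E < +oo)%E]].

Definition L2_eq (f g : T -> C) : Prop :=
  {ae mu, forall x, D x -> f x = g x}.

Definition L2_inner (f g : T -> C) : C :=
  (\int[mu]_(x in D) complex.Re (f x * (g x)^*))
  +i* (\int[mu]_(x in D) complex.Im (f x * (g x)^*)).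

(* The graph of psi |-> h psi, saturated for [L2_eq]. *)
Definition mult_operator (h : T -> R) : set ((T -> C) * (T -> C)) :=
  [set p | [/\ L2 p.1, L2 (fun x => (h x)%:C * p.1 x), L2 p.2 &
               L2_eq p.2 (fun x => (h x)%:C * p.1 x)]].

Definition unitary_ell2_L2 (U : (nat -> C) -> (T -> C)) : Prop :=
  [/\ forall x, ell2 x -> L2 (U x),
      forall (a : C) x y, ell2 x -> ell2 y ->
        L2_eq (U (fun n => a * x n + y n)) (fun t => a * U x t + U y t),
      forall x y, ell2 x -> ell2 y -> L2_inner (U x) (U y) = ell2_inner x y &
      forall f, L2 f -> exists2 x, ell2 x & L2_eq (U x) f].

(* The graph of U A U^-1, saturated for [L2_eq]. *)
Definition conj_operator (U : (nat -> C) -> (T -> C)) (A : ell2_operator R) :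
    set ((T -> C) * (T -> C)) :=
  [set p | [/\ L2 p.1, L2 p.2 &
    exists x y, [/\ A (x, y), L2_eq (U x) p.1 & L2_eq (U y) p.2]]].

End L2.

Section data.
Variable R : realType.

(* Euler's integral: the Gamma function for z > 0 only. *)
Definition Gamma (z : R) : R :=
  \int[lebesgue_measure]_(t in `]0, +oo[) (t `^ (z - 1) * expR (- t)).

Definition hermite (n : nat) (x : R) : R :=
  n`!%:R * \sum_(0 <= j < (n./2).+1)
    (-1) ^+ j * (2 * x) ^+ (n - j.*2) / (j`!%:R * (n - j.*2)`!%:R).

Definition hermite_normalized (n : nat) (x : R) : R :=
  (Num.sqrt (2 ^+ n * n`!%:R))^-1 * hermite n x.

Definition mu_density (x : R) : R := (Num.sqrt pi)^-1 * expR (- x ^+ 2).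

(* The measure on ]0, +oo[ with this density, as a measure on the real line. *)
Definition mu_half (V : set (measurableTypeR R)) : \bar R :=
  (\int[lebesgue_measure]_(x in V `&` `]0%R, +oo[) (mu_density x)%:E)%E.

Lemma measurable_mu_density (D : set R) : measurable_fun D mu_density.
Proof.
apply: measurable_funTS; apply: measurable_funM => //.
by apply: measurableT_comp => //; apply: measurableT_comp.
Qed.

Lemma mu_density_ge0 x : 0 <= mu_density x.
Proof. by rewrite mulr_ge0// ?invr_ge0 ?sqrtr_ge0 ?expR_ge0. Qed.

Let mu_half0 : mu_half set0 = 0%E.
Proof. by rewrite /mu_half set0I integral_set0. Qed.

Let mu_half_ge0 V : (0 <= mu_half V)%E.
Proof. by apply: integral_ge0 => x _; rewrite lee_fin mu_density_ge0. Qed.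

Let mu_half_sigma_additive : semi_sigma_additive mu_half.
Proof.
move=> F mF tF mUF; rewrite /mu_half setI_bigcupl ge0_integral_bigcup//=.
- apply: is_cvg_ereal_nneg_natsum => n _.
  by apply: integral_ge0 => x _; rewrite lee_fin mu_density_ge0.
- by move=> k; exact: measurableI.
- apply: (@measurable_funS _ _ _ _ setT) => //.
  by apply/measurable_EFinP; exact: measurable_mu_density.
- by move=> x _; rewrite lee_fin mu_density_ge0.
- exact: trivIset_setIr.
Qed.

HB.instance Definition _ :=
  isMeasure.Build _ _ _ mu_half mu_half0 mu_half_ge0 mu_half_sigma_additive.

Definition h_fun (x : R) : R := Num.sqrt (2 * pi) * expR (- x ^+ 2).

Definition H3e (m n : nat) : R :=
  (-1) ^+ (m + n) * Gamma ((m + n)%:R + 1 / 2)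
  / Num.sqrt ((2 * m)`!%:R * (2 * n)`!%:R).

Definition H3o (m n : nat) : R :=
  (-1) ^+ (m + n) * Gamma ((m + n)%:R + 3 / 2)
  / Num.sqrt ((2 * m + 1)`!%:R * (2 * n + 1)`!%:R).

End data.

(* Main.v *)
From HB Require Import structures.
Require Import Defs.
From mathcomp Require Import all_boot all_order all_algebra.
From mathcomp Require Import all_classical all_reals all_analysis.
From mathcomp Require Import measurable_realfun complex.
From mathcomp Require Import ring lra zify.
Set Implicit Arguments.
Unset Strict Implicit.
Unset Printing Implicit Defensive.
Import Order.TTheory GRing.Theory Num.Theory.
Import numFieldNormedType.Exports.
Local Open Scope classical_set_scope.
Local Open Scope ring_scope.
Local Open Scope complex_scope.

(** The two matrices are one and the same bounded operator seen in two
    orthonormal bases.  Restricted to the half line, the even normalized Hermite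
    polynomials, rescaled by the square root of 2, form an orthonormal basis of
    L^2(]0,+oo[, mu), and so do the odd ones: extending a function to the whole
    line with the right parity doubles its squared norm.  In these bases the
    multiplication by [h_fun] has the matrices [H3e] and [H3o].  Since [h_fun] is
    bounded, the rest is general ([diagonalization]): the synthesis map sending a
    square-summable sequence to the function with these Fourier coefficients is
    unitary (Riesz-Fischer and Parseval), it turns the formal matrix product into
    the multiplication operator ([mat_apply_coef]), and the matrix of a bounded
    operator has equal minimal and maximal operators, because finite truncations
    converge and coordinates are continuous ([determines_unique]).  Everything is
    done for real functions first; real and imaginary parts are treated
    separately.

    Two facts on Hermite polynomials remain.

    - Orthonormality on the half line ([parity_basis_orthonormal]) and the matrix
      elements of [h_fun] ([parity_matrixE]).  Both come from integrating
      (p e^(-c x^2))' over the half line ([poly_gauss_int_parts]), which leaves the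
      boundary term p(0).  For p = H_m H_n with m and n of opposite parity this term
      vanishes, and H_(n+1) = 2 X H_n - H_n' becomes a recursion on the
      integrals of H_m H_n.  For c = 1 it gives orthogonality; for c = 2 it is
      solved by values of the Gamma function at half-integers
      ([poly_gauss_int_hermite_gauss]).

    - Completeness ([parity_basis_total]).  A function orthogonal to all H_(2m+b)
      has, after multiplication by H_b, vanishing even moments.  As
      e^(-x^2/4) is the sum of a power series in x^2 that the Gaussian weight
      dominates, powers of e^(-x^2/4) may be inserted in these moments
      ([null_integral_moments]), then arbitrary polynomials in w = e^(-x^2/4).
      The polynomials (1 - w^n)^m, with m of order n b^(-n), converge boundedly to
      the indicator of w < b ([cvg_threshold]), so the function has
      integral zero over every ray, hence vanishes almost everywhere
      ([even_moments_zero]). *)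

(** * Square-integrable real functions *)

Section RealL2.
Context {d : measure_display} {T : measurableType d} {R : realType}.
Variables (mu : {measure set T -> \bar R}) (D : set T).
Hypothesis mD : measurable D.

Definition sqint (f : T -> R) :=
  measurable_fun D f /\ mu.-integrable D (fun x => (f x ^+ 2)%:E).

Definition ip (f g : T -> R) : R := \int[mu]_(x in D) (f x * g x).

Lemma ipE f g : ip f g = \int[mu]_(x in D) (f x * g x).
Proof. by []. Qed.

Lemma le_mul_integrable (f g : T -> R) : measurable_fun D f ->
  (forall x, D x -> `|f x| <= g x) -> mu.-integrable D (EFin \o g) ->
  mu.-integrable D (EFin \o f).
Proof.
move=> mf fg; apply: le_integrable => //; first exact/measurable_EFinP.
by move=> x Dx; rewrite /= lee_fin (le_trans (fg _ Dx))// ler_norm.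
Qed.

Lemma sqint_mulI f g : sqint f -> sqint g ->
  mu.-integrable D (EFin \o (fun x => f x * g x)).
Proof.
move=> [mf f2] [mg g2].
apply: (@le_mul_integrable _ (fun x => f x ^+ 2 + g x ^+ 2)).
- exact: measurable_funM.
- by move=> x _; rewrite normrM -(real_normK (num_real (f x)))
    -(real_normK (num_real (g x))); have := sqr_ge0 (`|f x| - `|g x|); nra.
- rewrite (_ : _ \o _ = (fun x => (f x ^+ 2)%:E) \+ (fun x => (g x ^+ 2)%:E))//.
  exact: integrableD.
Qed.

Lemma sqint_lin a f g : sqint f -> sqint g -> sqint (fun x => a * f x + g x).
Proof.
move=> sf sg; have [[mf f2] [mg g2]] := (sf, sg); split.
  by apply: measurable_funD => //; exact: measurable_funM.
rewrite (_ : (fun _ => _) = (fun x => ((a ^+ 2)%:E * (f x ^+ 2)%:E +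
   ((a *+ 2)%:E * (f x * g x)%:E) + (g x ^+ 2)%:E)%E)); last first.
  by apply/funext => x; rewrite -!EFinM -!EFinD; congr EFin; ring.
apply: integrableD => //; apply: integrableD => //; apply: integrableZl => //.
exact: sqint_mulI.
Qed.

Lemma sqint0 : sqint (fun=> 0).
Proof.
by split; [exact: measurable_cst|rewrite expr0n/=; exact: integrable0].
Qed.

Lemma sqintZ a f : sqint f -> sqint (fun x => a * f x).
Proof.
move=> sf; have := sqint_lin a sf sqint0.
by under eq_fun do rewrite addr0.
Qed.

Lemma sqintD f g : sqint f -> sqint g -> sqint (fun x => f x + g x).
Proof.
move=> sf sg; have := sqint_lin 1 sf sg.
by under eq_fun do rewrite mul1r.
Qed.

Lemma sqintB f g : sqint f -> sqint g -> sqint (fun x => f x - g x).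
Proof.
move=> sf sg; have := sqint_lin (-1) sg sf.
by under eq_fun do rewrite mulN1r addrC.
Qed.

Lemma ipC f g : ip f g = ip g f.
Proof. by apply: eq_Rintegral => x _; rewrite mulrC. Qed.

Lemma ip_lin a f g h : sqint f -> sqint g -> sqint h ->
  ip (fun x => a * f x + g x) h = a * ip f h + ip g h.
Proof.
move=> sf sg sh; rewrite /ip -RintegralZl//; last exact: sqint_mulI.
rewrite -RintegralD//; [|exact: integrableZl (sqint_mulI _ _)|exact: sqint_mulI].
by apply: eq_Rintegral => x _; rewrite mulrDl mulrA.
Qed.

Lemma ip_lin_r a f g h : sqint f -> sqint g -> sqint h ->
  ip h (fun x => a * f x + g x) = a * ip h f + ip h g.
Proof. by move=> *; rewrite ![ip h _]ipC ip_lin. Qed.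

Lemma ip0l h : ip (fun=> 0) h = 0.
Proof.
rewrite /ip; under eq_Rintegral do rewrite mul0r.
by rewrite /Rintegral integral0.
Qed.

Lemma ipZ a f h : sqint f -> sqint h -> ip (fun x => a * f x) h = a * ip f h.
Proof.
move=> sf sh; have := ip_lin a sf sqint0 sh; rewrite ip0l addr0 => <-.
by congr ip; apply/funext => x; rewrite addr0.
Qed.

Lemma ipB f g h : sqint f -> sqint g -> sqint h ->
  ip (fun x => f x - g x) h = ip f h - ip g h.
Proof.
move=> sf sg sh; have := ip_lin (-1) sg sf sh; rewrite mulN1r addrC => <-.
by congr ip; apply/funext => x; rewrite mulN1r addrC.
Qed.

Lemma ip_ge0 f : 0 <= ip f f.
Proof. by apply: Rintegral_ge0 => x _; rewrite -expr2 sqr_ge0. Qed.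

Lemma EFin_ip f : sqint f -> ((ip f f)%:E = \int[mu]_(x in D) (f x ^+ 2)%:E)%E.
Proof. by move=> [mf f2]; rewrite fineK// integrable_fin_num. Qed.

Lemma ip_ae f f' g : sqint f -> sqint f' -> sqint g ->
  {ae mu, forall x, D x -> f x = f' x} -> ip f g = ip f' g.
Proof.
move=> sf sf' sg ff'; congr fine; apply: ae_eq_integral => //.
- exact: measurable_int (sqint_mulI _ _).
- exact: measurable_int (sqint_mulI _ _).
- by apply: filterS ff' => x /[apply] ->.
Qed.

(** The quadratic form (a, b) |-> |a f + b g|^2 is nonnegative. It is evaluated at
    (|g|^2, - <f,g>), or, when |g| = 0, at a point where it would be -1 if <f,g> were
    not 0. *)
Lemma cauchy_schwarz f g : sqint f -> sqint g ->
  ip f g ^+ 2 <= ip f f * ip g g.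
Proof.
move=> sf sg.
have H a b : 0 <= a ^+ 2 * ip f f + 2 * a * b * ip f g + b ^+ 2 * ip g g.
  apply: le_trans (ip_ge0 (fun x => a * f x + (b * g x + 0))) _.
  have s1 : sqint (fun x => b * g x + 0) by exact: sqint_lin sqint0.
  have s2 : sqint (fun x => a * f x + (b * g x + 0)) by exact: sqint_lin.
  have s0 := sqint0.
  rewrite !ip_lin// !ip_lin_r// !ip0l [ip f (fun=> 0)]ipC [ip g (fun=> 0)]ipC !ip0l [ip g f]ipC.
  by rewrite le_eqVlt; apply/orP; left; apply/eqP; ring.
have := ip_ge0 g; rewrite le_eqVlt => /predU1P[g0|g0].
  rewrite -g0 mulr0; have [-> //|B0] := eqVneq (ip f g) 0; first by rewrite expr0n.
  (* b is chosen so that the form, which is affine in b, takes the value -1. *)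
  have := H 1 (- (ip f f + 1) / (2 * ip f g)); rewrite -g0.
  rewrite (_ : _ + _ = -1); last by field.
  by rewrite ler0N1.
have := H (ip g g) (- ip f g).
rewrite (_ : _ + _ = ip g g * (ip f f * ip g g - ip f g ^+ 2)); last by ring.
by rewrite pmulr_rge0// subr_ge0.
Qed.

Lemma geometric_half_partial n :
  \sum_(k < n) (2^-1 : R) ^+ k = 2 - 2 * 2^-1 ^+ n.
Proof.
elim: n => [|n IH]; first by rewrite big_ord0 expr0 mulr1 subrr.
by rewrite big_ord_recr/= IH exprS; lra.
Qed.

(** Weighting the k-th squared increment by 4^k keeps the sum of the integrals
    finite, so the weighted sum is finite almost everywhere. There the k-th
    increment is O(2^-k) and the telescoping series converges absolutely. *)
Lemma fast_cauchy_ae (t : nat -> T -> R) : (forall k, sqint (t k)) ->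
  (forall k, ip (fun x => t k x - t k.+1 x) (fun x => t k x - t k.+1 x)
             <= 8^-1 ^+ k) ->
  {ae mu, forall x, D x -> cvgn (t ^~ x)}.
Proof.
move=> st dt.
pose F k x := ((4 ^+ k * (t k x - t k.+1 x) ^+ 2)%:E : \bar R).
have F0 k x : (0 <= F k x)%E by rewrite lee_fin mulr_ge0// ?sqr_ge0// exprn_ge0.
have sd k : sqint (fun x => t k x - t k.+1 x) by exact: sqintB.
have mF k : measurable_fun D (F k).
  by apply/measurable_EFinP/measurable_funM => //; apply: measurable_funX; exact: (sd k).1.
have intF : (\int[mu]_(x in D) (\sum_(k <oo) F k x) <= 2%:E)%E.
  rewrite integral_nneseries//.
  apply: lime_le; first by apply: is_cvg_nneseries => n _ _; exact: integral_ge0.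
  apply: nearW => n.
  apply: (@le_trans _ _ (\sum_(0 <= k < n) (2^-1 ^+ k)%:E)%E); last first.
    rewrite sumEFin lee_fin big_mkord geometric_half_partial.
    by rewrite gerBl mulr_ge0// exprn_ge0.
  apply: lee_sum => k _; rewrite /F.
  under eq_integral do rewrite EFinM.
  rewrite ge0_integralZl_EFin//; last 2 first.
  - by move=> x _; rewrite lee_fin sqr_ge0.
  - by apply/measurable_EFinP; apply: measurable_funX; exact: (sd k).1.
  rewrite -EFin_ip// -EFinM lee_fin (le_trans (ler_wpM2l _ (dt k)))//.
  by rewrite -exprMn (_ : 4 * 8^-1 = 2^-1 :> R)//; lra.
have : mu.-integrable D (fun x => \sum_(k <oo) F k x)%E.
  apply/integrableP; split.
    by apply: ge0_emeasurable_sum.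
  apply: le_lt_trans (ltry 2); apply: le_trans intF.
  rewrite le_eqVlt; apply/orP; left; apply/eqP/eq_integral => x _.
  by rewrite gee0_abs// nneseries_ge0.
move=> /(integrable_ae mD); apply: filterS => x /[apply] Sfin.
set S := fine (\sum_(k <oo) F k x)%E.
have leS k : (t k x - t k.+1 x) ^+ 2 <= S * (2^-1 ^+ k) ^+ 2.
  have : (F k x <= S%:E)%E.
    rewrite /S fineK//; apply: le_trans (nneseries_lim_ge k.+1 _) => //.
    by rewrite big_nat_recr//= leeDr// sume_ge0.
  rewrite lee_fin -exprM mulnC exprM (_ : 2^-1 ^+ 2 = 4^-1 :> R); last first.
    by rewrite exprVn -natrX.
  by rewrite exprVn ler_pdivlMr ?exprn_gt0// mulrC.
have S0 : 0 <= S by rewrite fine_ge0// nneseries_ge0.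
have : cvgn (series (fun k => t k.+1 x - t k x)).
  apply: normed_cvg.
  apply: (@series_le_cvg _ _ (geometric (Num.sqrt S) 2^-1)).
  - by move=> n; exact: normr_ge0.
  - by move=> n; rewrite /= mulr_ge0// ?sqrtr_ge0 ?exprn_ge0.
  - move=> n; rewrite /= -[X in X <= _]sqrtr_sqr -[X in _ * X]ger0_norm ?exprn_ge0//.
    rewrite -sqrtr_sqr -sqrtrM// ler_wsqrtr//.
    by rewrite -sqrrN opprB.
  - by apply: is_cvg_geometric_series; rewrite ger0_norm//; lra.
rewrite (_ : series _ = (fun k => t k x - t 0%N x)); last first.
  by apply/funext => n; rewrite /series/= telescope_sumr.
move=> /cvg_ex[l tl]; apply/cvg_ex; exists (l + t 0%N x).
rewrite (_ : t ^~ x = fun k => (t k x - t 0%N x) + t 0%N x).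
  by apply: cvgD => //; exact: cvg_cst.
by apply/funext => k /=; rewrite subrK.
Qed.

(** The Riesz-Fischer argument: a rapidly Cauchy subsequence converges almost
    everywhere, and Fatou's lemma bounds the distance from its limit to the terms
    of the original sequence. The limit superior provides a measurable
    representative of the limit. *)
Lemma L2_complete (s : nat -> T -> R) : (forall n, sqint (s n)) ->
  (forall e, 0 < e -> exists N, forall m n, (N <= m)%N -> (N <= n)%N ->
     ip (fun x => s m x - s n x) (fun x => s m x - s n x) <= e) ->
  exists2 f, sqint f &
    ip (fun x => s n x - f x) (fun x => s n x - f x) @[n --> \oo] --> (0 : R).
Proof.
move=> ss sC.
have /choice[N0 N0P] : forall k, exists N, forall m n, (N <= m)%N -> (N <= n)%N ->
    ip (fun x => s m x - s n x) (fun x => s m x - s n x) <= 8^-1 ^+ k.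
  by move=> k; apply: sC; rewrite exprn_gt0.
(* The maximum makes N nondecreasing; adding k makes it tend to infinity. *)
pose N k := (k + \max_(i < k.+1) N0 i)%N.
have N0N k : (N0 k <= N k)%N.
  by apply: leq_trans (leq_addl _ _); exact: (leq_bigmax (ord_max : 'I_k.+1)).
have NS k : (N k <= N k.+1)%N.
  by rewrite leq_add// [leqRHS]big_ord_recr/= leq_maxl.
pose t k := s (N k).
have tC := @fast_cauchy_ae t (fun k => ss _)
  (fun k => N0P k _ _ (N0N k) (leq_trans (N0N k) (NS k))).
pose f x := fine (limn_esup (fun k => (t k x)%:E)).
have mf : measurable_fun D f.
  apply: measurableT_comp => //; apply: measurable_fun_limn_esup => n.
  by apply/measurable_EFinP; exact: (ss _).1.
have {}tC : {ae mu, forall x, D x -> t ^~ x @ \oo --> f x}.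
  apply: filterS tC => x /[apply] /cvg_ex[l tl].
  have tlE : (t k x)%:E @[k --> \oo] --> l%:E by apply: cvg_EFin => //; exact: nearW.
  by rewrite /f (cvg_limn_einf_sup tlE).2.
have sd n k : sqint (fun x => t k x - s n x) by exact: sqintB (ss _) (ss _).
have key e n K : 0 < e -> (forall k, (K <= k)%N ->
     ip (fun x => t k x - s n x) (fun x => t k x - s n x) <= e) ->
   (\int[mu]_(x in D) ((f x - s n x) ^+ 2)%:E <= e%:E)%E.
  move=> e0 tse.
  have -> : (\int[mu]_(x in D) ((f x - s n x) ^+ 2)%:E =
    \int[mu]_(x in D) (limn_einf (fun k => ((t (k + K)%N x - s n x) ^+ 2)%:E)))%E.
    apply: ae_eq_integral => //.
    - apply/measurable_EFinP; apply: measurable_funX; apply: measurable_funB => //.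
      exact: (ss _).1.
    - rewrite (_ : (fun=> _) = (fun x => - limn_esup
        (fun k => - ((t (k + K)%N x - s n x) ^+ 2)%:E)%E)%E); last first.
        by apply/funext => x; rewrite -limn_einfN; congr limn_einf;
           apply/funext => k; rewrite /= opprK.
      apply: measurableT_comp => //; apply: measurable_fun_limn_esup => k.
      apply: measurableT_comp => //.
      by apply/measurable_EFinP; apply: measurable_funX; exact: (sd _ _).1.
    - apply: filterS tC => x /[apply] txf; apply/esym.
      have H : ((t (k + K)%N x - s n x) ^+ 2)%:E @[k --> \oo] -->
               ((f x - s n x) ^+ 2)%:E.
        apply: cvg_EFin; first exact: nearW.
        have cd : t (k + K)%N x - s n x @[k --> \oo] --> f x - s n x.
          apply: cvgB; last exact: cvg_cst.
          by rewrite (cvg_shiftn K (t ^~ x)).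
        rewrite expr2; under eq_fun do rewrite expr2.
        exact: cvgM.
      by rewrite (cvg_limn_einf_sup H).1.
  apply: le_trans (fatou _ _ _ _) _ => //.
  - by move=> k; apply/measurable_EFinP; apply: measurable_funX; exact: (sd _ _).1.
  - by move=> k x _; rewrite lee_fin sqr_ge0.
  rewrite limn_einf_lim; apply: lime_le; first exact: is_cvg_einfs.
  apply: nearW => k; apply: (@le_trans _ _
    (\int[mu]_(x in D) ((t (k + K)%N x - s n x) ^+ 2)%:E)%E).
    by apply: ereal_inf_lbound; exists k => /=.
  by rewrite -EFin_ip// lee_fin tse// leq_addl.
have lim_le e : 0 < e -> exists M, forall n, (M <= n)%N ->
    (\int[mu]_(x in D) ((f x - s n x) ^+ 2)%:E <= e%:E)%E.
  move=> e0; have [M MP] := sC _ e0; exists M => n Mn.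
  apply: (key e n M) => // k Mk; apply: MP => //.
  by rewrite (leq_trans Mk)// leq_addr.
have sf : sqint f.
  have [M /(_ M (leqnn _)) fM] := lim_le 1 ltr01.
  have mfM : measurable_fun D (fun x => f x - s M x).
    by apply: measurable_funB => //; exact: (ss _).1.
  have sfM : sqint (fun x => f x - s M x).
    split => //; apply/integrableP; split.
      by apply/measurable_EFinP; exact: measurable_funX.
    under eq_integral => x _ do rewrite gee0_abs ?lee_fin ?sqr_ge0//.
    by rewrite (le_lt_trans fM)// ltry.
  have := sqintD sfM (ss M).
  by under eq_fun do rewrite subrK.
exists f => //; apply/cvgrPdist_le => e e0.
have [M MP] := lim_le e e0; exists M => // n /= Mn.
rewrite sub0r normrN ger0_norm ?ip_ge0// -lee_fin EFin_ip ?MP//; last first.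
  exact: sqintB.
under eq_integral do rewrite -sqrrN opprB.
exact: MP.
Qed.

End RealL2.
Arguments ip : simpl never.

(** * Orthonormal bases of real functions *)

Section OrthonormalBasis.
Context {d : measure_display} {T : measurableType d} {R : realType}.
Variables (mu : {measure set T -> \bar R}) (D : set T).
Hypothesis mD : measurable D.
Variable phi : nat -> T -> R.
Hypothesis sphi : forall n, sqint mu D (phi n).
Hypothesis ophi : forall m n, ip mu D (phi m) (phi n) = (m == n)%:R.

Local Notation sqint := (sqint mu D).
Local Notation ip := (ip mu D).

Definition fourier_sum (c : nat -> R) N : T -> R := fun x => \sum_(k < N) c k * phi k x.

Lemma fourier_sumS c N : fourier_sum c N.+1 = fun x => c N * phi N x + fourier_sum c N x.
Proof. by apply/funext => x; rewrite /fourier_sum big_ord_recr/= addrC. Qed.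

Lemma fourier_sum0 c : fourier_sum c 0 = fun=> 0.
Proof. by apply/funext => x; rewrite /fourier_sum big_ord0. Qed.

Lemma sqint_fourier_sum c N : sqint (fourier_sum c N).
Proof.
elim: N => [|N IH]; first by rewrite fourier_sum0; exact: sqint0.
by rewrite fourier_sumS; exact: sqint_lin.
Qed.

Lemma ip_fourier_sum c N g : sqint g ->
  ip (fourier_sum c N) g = \sum_(k < N) c k * ip (phi k) g.
Proof.
move=> sg; elim: N => [|N IH]; first by rewrite fourier_sum0 big_ord0 ip0l.
rewrite fourier_sumS ip_lin//; last exact: sqint_fourier_sum.
by rewrite big_ord_recr/= IH addrC.
Qed.

Lemma ip_fourier_sum_phi c N n : (n < N)%N -> ip (fourier_sum c N) (phi n) = c n.
Proof.
move=> nN; rewrite ip_fourier_sum// (bigD1 (Ordinal nN))//= ophi eqxx mulr1.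
rewrite big1 ?addr0// => k kn; rewrite ophi (_ : _ == _ = false) ?mulr0//.
by apply/negbTE; apply: contra kn => /eqP kn; apply/eqP/val_inj.
Qed.

Lemma ip_fourier_sum2 c N : ip (fourier_sum c N) (fourier_sum c N) = \sum_(k < N) c k ^+ 2.
Proof.
rewrite ip_fourier_sum; last exact: sqint_fourier_sum.
by apply: eq_bigr => k _; rewrite ipC ip_fourier_sum_phi.
Qed.

Lemma fourier_sumB c N M : (N <= M)%N ->
  (fun x => fourier_sum c M x - fourier_sum c N x) =
  fourier_sum (fun k => if (k < N)%N then 0 else c k) M.
Proof.
move=> NM; apply/funext => x; rewrite /fourier_sum.
rewrite -!(big_mkord xpredT (fun k => c k * phi k x)).
rewrite -(big_mkord xpredT (fun k => (if (k < N)%N then 0 else c k) * phi k x)).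
rewrite (@big_cat_nat _ _ _ N 0 M xpredT _ (leq0n N) NM)//=.
rewrite [RHS](@big_cat_nat _ _ _ N 0 M xpredT _ (leq0n N) NM)//= [LHS]addrC addKr.
rewrite [X in _ = X + _]big_nat_cond.
rewrite [X in _ = X + _]big1 ?add0r; last by move=> k /andP[/andP[_ ->] _]; rewrite mul0r.
by apply: eq_big_nat => k /andP[Nk _]; rewrite ltnNge Nk.
Qed.

Lemma ip_fourier_sumB c N M : (N <= M)%N ->
  ip (fun x => fourier_sum c M x - fourier_sum c N x)
     (fun x => fourier_sum c M x - fourier_sum c N x)
  = series (fun k => c k ^+ 2) M - series (fun k => c k ^+ 2) N.
Proof.
move=> NM; rewrite fourier_sumB// ip_fourier_sum2 sub_series_geq//.
rewrite -(big_mkord xpredT (fun k => (if (k < N)%N then 0 else c k) ^+ 2)).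
rewrite (@big_cat_nat _ _ _ N 0 M xpredT _ (leq0n N) NM)//= [X in X + _]big_nat_cond.
rewrite [X in X + _]big1 ?add0r; last by move=> k /andP[/andP[_ ->] _]; rewrite expr0n.
by apply: eq_big_nat => k /andP[Nk _]; rewrite ltnNge Nk.
Qed.

(** By [cauchy_schwarz], applied to the differences. *)
Lemma ip_cvg (s : nat -> T -> R) f g : (forall n, sqint (s n)) -> sqint f -> sqint g ->
  ip (fun x => s n x - f x) (fun x => s n x - f x) @[n --> \oo] --> (0 : R) ->
  ip (s n) g @[n --> \oo] --> ip f g.
Proof.
move=> ss sf sg sfl.
have sd n : sqint (fun x => s n x - f x) by exact: sqintB.
have H : (ip (s n) g - ip f g) ^+ 2 @[n --> \oo] --> (0 : R).
  apply: (@squeeze_cvgr _ _ _ _ (fun=> 0)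
    (fun n => ip (fun x => s n x - f x) (fun x => s n x - f x) * ip g g)).
  - apply: nearW => n; rewrite sqr_ge0/= -ipB//.
    exact: cauchy_schwarz.
  - exact: cvg_cst.
  - by rewrite -[X in _ --> X](mul0r (ip g g)); apply: cvgM => //; exact: cvg_cst.
have : Num.sqrt ((ip (s n) g - ip f g) ^+ 2) @[n --> \oo] --> (0 : R).
  rewrite -[X in _ --> X]sqrtr0.
  by apply: (@continuous_cvg _ _ _ _ _ _ (@Num.sqrt R)) => //; exact: sqrt_continuous.
under eq_fun do rewrite sqrtr_sqr.
by move=> /norm_cvg0 /subr_cvg0.
Qed.

(** The squared norm of a block of the Fourier series is a block of the series of
    squares, so partial sums are Cauchy and [L2_complete] applies. *)
Lemma fourier_series_exists (c : nat -> R) : cvgn (series (fun k => c k ^+ 2)) ->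
  exists f, [/\ sqint f, (forall n, ip f (phi n) = c n) &
    ip (fun x => fourier_sum c n x - f x) (fun x => fourier_sum c n x - f x)
       @[n --> \oo] --> (0 : R)].
Proof.
move=> cc.
have [] := @L2_complete _ _ _ mu D mD (fourier_sum c) (sqint_fourier_sum c).
  move=> e e0; move/cauchy_cvgP/cauchy_seriesP : (cc) => /(_ _ e0).
  case=> -[A B] /= [[a _ aA] [b _ bB]] AB.
  exists (maxn a b) => m n mN nN.
  wlog mn : m n mN nN / (n <= m)%N.
    move=> H; have [nm|/ltnW mn] := leqP n m; first exact: H.
    rewrite (_ : ip _ _ = ip (fun x => fourier_sum c n x - fourier_sum c m x)
      (fun x => fourier_sum c n x - fourier_sum c m x)); first exact: H.
    by apply: eq_Rintegral => x _; ring.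
  rewrite ip_fourier_sumB// sub_series_geq//.
  have := AB (n, m); rewrite /= => /(_ _)/ltW; rewrite ger0_norm; last first.
    by apply: sumr_ge0 => k _; exact: sqr_ge0.
  apply; split; [apply: aA|apply: bB] => /=.
  - by rewrite (leq_trans _ nN)// leq_maxl.
  - by rewrite (leq_trans _ mN)// leq_maxr.
move=> f sf fl; exists f; split => // n.
have := ip_cvg (sqint_fourier_sum c) sf (sphi n) fl.
move=> /cvg_lim <-//; apply: lim_near_cst => //.
by exists n.+1 => // N /= nN; rewrite ip_fourier_sum_phi.
Qed.

Lemma bessel f : sqint f -> cvgn (series (fun k => ip f (phi k) ^+ 2)).
Proof.
move=> sf; apply: nondecreasing_is_cvgn.
  by apply: nondecreasing_series => k _ _; exact: sqr_ge0.
exists (ip f f) => _ [N _ <-].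
pose c k := ip f (phi k); pose s := fourier_sum c N.
have ss : sqint s by exact: sqint_fourier_sum.
have := ip_ge0 mu D (fun x => f x - s x).
rewrite ipB//; last exact: sqintB.
rewrite [ip f _]ipC [ip s _]ipC !ipB//.
have fs : ip f s = \sum_(k < N) c k ^+ 2.
  by rewrite ipC ip_fourier_sum//; apply: eq_bigr => k _; rewrite ipC.
rewrite [ip s f]ipC fs [ip s s]ip_fourier_sum2 /series/= big_mkord subrr subr0.
by rewrite subr_ge0.
Qed.

Hypothesis total : forall f, sqint f -> (forall n, ip f (phi n) = 0) ->
  {ae mu, forall x, D x -> f x = 0}.

(** Totality, applied to a difference. *)
Lemma coef_inj f g : sqint f -> sqint g ->
  (forall n, ip f (phi n) = ip g (phi n)) -> {ae mu, forall x, D x -> f x = g x}.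
Proof.
move=> sf sg fg; have := total (sqintB mD sf sg).
move=> /(_ _)-/(_ _)/(filterS _); apply.
  by move=> x /[apply] /eqP; rewrite subr_eq0 => /eqP.
by move=> n; rewrite ipB// fg subrr.
Qed.

(** The Fourier series of f converges in norm to a function with the same
    coefficients as f, hence to f itself by totality. Pairing its partial sums with g
    gives the series. *)
Lemma parseval f g : sqint f -> sqint g ->
  series (fun k => ip f (phi k) * ip g (phi k)) @ \oo --> ip f g.
Proof.
move=> sf sg; have [f' [sf' f'E f'l]] := fourier_series_exists (bessel sf).
rewrite (@ip_ae _ _ _ mu D mD f f')//; last by apply: coef_inj => // n; rewrite f'E.
have := ip_cvg (sqint_fourier_sum _) sf' sg f'l.
rewrite (_ : (fun n => _) = series (fun k => ip f (phi k) * ip g (phi k)))//.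
apply/funext => N; rewrite ip_fourier_sum// /series/= big_mkord.
by apply: eq_bigr => k _; rewrite [ip g _]ipC.
Qed.

End OrthonormalBasis.

(** * Complex sequences *)

Section ComplexLemmas.
Variable R : realType.
Implicit Types x y : R[i].

Lemma complex_eqP x y : complex.Re x = complex.Re y -> complex.Im x = complex.Im y -> x = y.
Proof. by case: x; case: y => a b c e /= -> ->. Qed.

Lemma ReM x y : complex.Re (x * y) =
  complex.Re x * complex.Re y - complex.Im x * complex.Im y.
Proof. by case: x; case: y. Qed.

Lemma ImM x y : complex.Im (x * y) =
  complex.Re x * complex.Im y + complex.Im x * complex.Re y.
Proof. by case: x; case: y. Qed.

Lemma ReDc x y : complex.Re (x + y) = complex.Re x + complex.Re y.
Proof. by case: x; case: y. Qed.

Lemma ImDc x y : complex.Im (x + y) = complex.Im x + complex.Im y.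
Proof. by case: x; case: y. Qed.

Lemma ReBc x y : complex.Re (x - y) = complex.Re x - complex.Re y.
Proof. by case: x; case: y. Qed.

Lemma ImBc x y : complex.Im (x - y) = complex.Im x - complex.Im y.
Proof. by case: x; case: y. Qed.

Lemma ReJ y : complex.Re (y^*) = complex.Re y.
Proof. by case: y. Qed.

Lemma ImJ y : complex.Im (y^*) = - complex.Im y.
Proof. by case: y. Qed.

Lemma normc_sqr x : Normc.normc x ^+ 2 = complex.Re x ^+ 2 + complex.Im x ^+ 2.
Proof. by case: x => a b /=; rewrite sqr_sqrtr// addr_ge0// sqr_ge0. Qed.

Lemma normc_ge0 x : 0 <= Normc.normc x.
Proof. by case: x => a b /=; exact: sqrtr_ge0. Qed.

Lemma ReR (a : R) : complex.Re a%:C = a. Proof. by []. Qed.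
Lemma ImR (a : R) : complex.Im a%:C = 0. Proof. by []. Qed.

Definition cE := (ReM, ImM, ReDc, ImDc, ReBc, ImBc, ReJ, ImJ, ReR, ImR).

Lemma cvg_series_eq (u v : nat -> R) (l : R) : u =1 v ->
  series u @ \oo --> l -> series v @ \oo --> l.
Proof. by move=> /funext ->. Qed.

Lemma ell2P (z : nat -> R[i]) : ell2 z <->
  cvgn (series (fun n => complex.Re (z n) ^+ 2)) /\
  cvgn (series (fun n => complex.Im (z n) ^+ 2)).
Proof.
rewrite /ell2/=; under eq_fun do rewrite normc_sqr.
split=> [zz|[z1 z2]].
  by split; apply: series_le_cvg zz => n; rewrite ?addr_ge0 ?lerDl ?lerDr ?sqr_ge0.
rewrite (_ : series _ = series (fun n => complex.Re (z n) ^+ 2) +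
  series (fun n => complex.Im (z n) ^+ 2)); first exact: is_cvgD.
by apply/funext => n; rewrite fctE /series/= -big_split.
Qed.

Lemma normc_le_ell2_norm (z : nat -> R[i]) n : ell2 z ->
  Normc.normc (z n) <= ell2_norm z.
Proof.
move=> zz; rewrite -[leLHS]ger0_norm ?normc_ge0// -sqrtr_sqr ler_wsqrtr//.
apply: le_trans (nondecreasing_cvgn_le _ zz n.+1).
  by rewrite /series/= big_nat_recr//= lerDr sumr_ge0// => k _; exact: sqr_ge0.
by apply: nondecreasing_series => k _ _; exact: sqr_ge0.
Qed.

Lemma ell2_span (x : nat -> R[i]) : span_ebasis x -> ell2 x.
Proof.
move=> [N [c ->]]; rewrite /ell2/=.
apply/cvg_ex; exists (series (fun n => Normc.normc (\sum_(k < N) c k * ebasis R k n) ^+ 2) N).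
apply: cvg_near_cst; exists N => // n /= Nn.
apply/eqP; rewrite -subr_eq0 sub_series_geq// big_nat_cond big1// => k.
move=> /andP[/andP[Nk _] _]; rewrite big1.
  by rewrite normc_sqr/= expr0n addr0.
move=> i _; rewrite /ebasis (_ : _ == _ = false) ?mulr0//.
by apply/negbTE; rewrite neq_ltn orbC (leq_trans (ltn_ord i) Nk).
Qed.

Definition truncate (x : nat -> R[i]) N : nat -> R[i] :=
  fun n => if (n < N)%N then x n else 0.

Lemma span_truncate (x : nat -> R[i]) N : span_ebasis (truncate x N).
Proof.
exists N, (fun i => x i); apply/funext => n; rewrite /truncate.
case: ltnP => nN.
  rewrite (bigD1 (Ordinal nN))//= /ebasis eqxx mulr1 big1 ?addr0// => k kn.
  rewrite (_ : _ == _ = false) ?mulr0//.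
  by apply/negbTE; apply: contra kn => /eqP kn; apply/eqP/val_inj.
rewrite big1// => k _; rewrite /ebasis (_ : _ == _ = false) ?mulr0//.
by apply/negbTE; rewrite neq_ltn orbC (leq_trans (ltn_ord k) nN).
Qed.

Lemma ell2_norm_truncate (x : nat -> R[i]) : ell2 x ->
  ell2_norm (truncate x k \- x) @[k --> \oo] --> (0 : R).
Proof.
move=> xx; rewrite -[X in _ --> X]sqrtr0 /ell2_norm.
apply: (@continuous_cvg _ _ _ _ _ _ (@Num.sqrt R)); first exact: sqrt_continuous.
set S := series (fun n => Normc.normc (x n) ^+ 2).
rewrite (_ : (fun k => _) = (fun k => limn S - S k)).
  rewrite -(subrr (limn S)); apply: cvgB; [exact: cvg_cst|exact: xx].
apply/funext => k; apply/cvg_lim => //.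
apply: cvg_trans (cvgB xx (cvg_cst (S k))).
apply: near_eq_cvg; exists k => // n /= kn.
rewrite fctE sub_series_geq//.
rewrite [RHS]/series/= (@big_cat_nat _ _ _ k 0 n xpredT _ (leq0n k) kn)//=.
rewrite [X in _ = X + _]big_nat_cond [X in _ = X + _]big1 ?add0r; last first.
  by move=> i /andP[/andP[_ ik] _]; rewrite /truncate ik subrr normc_sqr expr0n addr0.
apply: eq_big_nat => i /andP[ki _].
by rewrite /truncate ltnNge ki/= !normc_sqr sub0r; case: (x i) => a b /=; rewrite !sqrrN.
Qed.

End ComplexLemmas.

(** * Complex square-integrable functions and bounded multiplication operators *)

Section ComplexL2.
Context {d : measure_display} {T : measurableType d} {R : realType}.
Variables (mu : {measure set T -> \bar R}) (D : set T).
Hypothesis mD : measurable D.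
Local Notation C := R[i].
Implicit Types F G : T -> C.

Local Notation sqint := (sqint mu D).
Local Notation ip := (ip mu D).
Local Notation re F := (fun x => complex.Re (F x)).
Local Notation im F := (fun x => complex.Im (F x)).

Lemma L2P F : L2 mu D F <-> sqint (re F) /\ sqint (im F).
Proof.
split=> [[mr mi fin]|[[mr ir] [mi ii]]].
  have mn : measurable_fun D (fun x => Normc.normc (F x) ^+ 2).
    under eq_fun do rewrite normc_sqr.
    by apply: measurable_funD; apply: measurable_funX.
  have iF : mu.-integrable D (EFin \o (fun x => Normc.normc (F x) ^+ 2)).
    apply/integrableP; split; first exact/measurable_EFinP.
    under eq_integral => x _ do rewrite gee0_abs ?lee_fin ?sqr_ge0//.
    exact: fin.
  split; split => //.
  - apply: le_mul_integrable iF => //; first exact: measurable_funX.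
    by move=> x _; rewrite normc_sqr ger0_norm ?sqr_ge0// lerDl sqr_ge0.
  - apply: le_mul_integrable iF => //; first exact: measurable_funX.
    by move=> x _; rewrite normc_sqr ger0_norm ?sqr_ge0// lerDr sqr_ge0.
split => //.
under eq_integral do rewrite normc_sqr EFinD.
have /integrableP[_] := integrableD mD ir ii.
under eq_integral => x _ do rewrite gee0_abs ?adde_ge0 ?lee_fin ?sqr_ge0//.
by [].
Qed.

Lemma L2_eq_re F G : L2_eq mu D F G ->
  {ae mu, forall x, D x -> complex.Re (F x) = complex.Re (G x)}.
Proof. by apply: filterS => x /[apply] ->. Qed.

Lemma L2_eq_im F G : L2_eq mu D F G ->
  {ae mu, forall x, D x -> complex.Im (F x) = complex.Im (G x)}.
Proof. by apply: filterS => x /[apply] ->. Qed.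

Lemma L2_eq_sym F G : L2_eq mu D F G -> L2_eq mu D G F.
Proof. by apply: filterS => x /[apply] ->. Qed.

Lemma L2_eq_trans F G H : L2_eq mu D F G -> L2_eq mu D G H -> L2_eq mu D F H.
Proof. by apply: filterS2 => x FG GH Dx; rewrite FG// GH. Qed.

Lemma L2_lin a F G : L2 mu D F -> L2 mu D G -> L2 mu D (fun x => a * F x + G x).
Proof.
move=> /L2P[F1 F2] /L2P[G1 G2]; apply/L2P; split.
  under eq_fun do rewrite !cE -mulNr.
  by apply: sqintD => //; apply: sqint_lin => //; exact: sqintZ.
under eq_fun do rewrite !cE.
by apply: sqintD => //; apply: sqint_lin => //; exact: sqintZ.
Qed.

Definition normL2sq F := ip (re F) (re F) + ip (im F) (im F).

Variable phi : nat -> T -> R.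
Hypothesis sphi : forall n, sqint (phi n).
Hypothesis ophi : forall m n, ip (phi m) (phi n) = (m == n)%:R.
Hypothesis total : forall f, sqint f -> (forall n, ip f (phi n) = 0) ->
  {ae mu, forall x, D x -> f x = 0}.

(** As the basis functions are real, the coefficient of F is assembled from those of
    its real and imaginary parts. *)
Definition coef F n : C := ip (re F) (phi n) +i* ip (im F) (phi n).

Lemma Re_coef F n : complex.Re (coef F n) = ip (re F) (phi n). Proof. by []. Qed.
Lemma Im_coef F n : complex.Im (coef F n) = ip (im F) (phi n). Proof. by []. Qed.

Lemma coef_lin a F G : L2 mu D F -> L2 mu D G ->
  coef (fun x => a * F x + G x) = fun n => a * coef F n + coef G n.
Proof.
move=> /L2P[F1 F2] /L2P[G1 G2]; apply/funext => n; apply: complex_eqP.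
  rewrite [LHS](_ : _ = ip (fun x => complex.Re a * complex.Re (F x) +
    (- complex.Im a * complex.Im (F x) + complex.Re (G x))) (phi n)); last first.
    by congr (ip _ _); apply/funext => x; rewrite !cE; ring.
  rewrite ip_lin//; last exact: sqint_lin.
  by rewrite ip_lin// !cE mulNr addrA.
rewrite [LHS](_ : _ = ip (fun x => complex.Re a * complex.Im (F x) +
  (complex.Im a * complex.Re (F x) + complex.Im (G x))) (phi n)); last first.
  by congr (ip _ _); apply/funext => x; rewrite !cE; ring.
rewrite ip_lin//; last exact: sqint_lin.
by rewrite ip_lin// !cE addrA.
Qed.

Lemma coef_ae F G : L2 mu D F -> L2 mu D G -> L2_eq mu D F G -> coef F = coef G.
Proof.
move=> /L2P[F1 F2] /L2P[G1 G2] FG; apply/funext => n; rewrite /coef.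
by rewrite (ip_ae mD F1 G1 (sphi n) (L2_eq_re FG)) (ip_ae mD F2 G2 (sphi n) (L2_eq_im FG)).
Qed.

Lemma coef_injC F G : L2 mu D F -> L2 mu D G -> coef F = coef G -> L2_eq mu D F G.
Proof.
move=> /L2P[F1 F2] /L2P[G1 G2] FG.
have c1 := coef_inj mD sphi total F1 G1 (fun n => congr1 (@complex.Re R) (congr1 (@^~ n) FG)).
have c2 := coef_inj mD sphi total F2 G2 (fun n => congr1 (@complex.Im R) (congr1 (@^~ n) FG)).
by move: c1 c2; apply: filterS2 => x c1 c2 Dx; apply: complex_eqP; [exact: c1|exact: c2].
Qed.

Lemma ell2_coef F : L2 mu D F -> ell2 (coef F).
Proof.
by move=> /L2P[F1 F2]; apply/ell2P; split => /=;
  [exact: (bessel mD sphi ophi F1)|exact: (bessel mD sphi ophi F2)].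
Qed.

Lemma limnD_parseval (f g f' g' : T -> R) : sqint f -> sqint g -> sqint f' -> sqint g' ->
  series (fun n => ip f (phi n) * ip g (phi n) + ip f' (phi n) * ip g' (phi n))
    @ \oo --> ip f g + ip f' g'.
Proof.
move=> sf sg sf' sg'.
have := cvgD (parseval mD sphi ophi total sf sg) (parseval mD sphi ophi total sf' sg').
by rewrite -seriesD => H; apply: H.
Qed.

Lemma ell2_norm_coef F : L2 mu D F -> ell2_norm (coef F) = Num.sqrt (normL2sq F).
Proof.
move=> /L2P[F1 F2]; congr Num.sqrt; apply/cvg_lim => //.
apply: cvg_series_eq (limnD_parseval F1 F1 F2 F2) => n.
by rewrite normc_sqr/= !expr2.
Qed.

Lemma L2_inner_coef F G : L2 mu D F -> L2 mu D G ->
  L2_inner mu D F G = ell2_inner (coef F) (coef G).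
Proof.
move=> /L2P[F1 F2] /L2P[G1 G2]; apply: complex_eqP; rewrite [LHS]/=.
  transitivity (ip (re F) (re G) + ip (im F) (im G)).
    rewrite !ipE -RintegralD//; [|exact: sqint_mulI|exact: sqint_mulI].
    by apply: eq_Rintegral => x _; rewrite !cE mulrN opprK.
  apply/esym/cvg_lim => //.
  apply: cvg_series_eq (limnD_parseval F1 G1 F2 G2) => n.
  by rewrite !cE mulrN opprK.
transitivity (ip (im F) (re G) + ip (fun x => -1 * complex.Re (F x)) (im G)).
  rewrite !ipE -RintegralD//; [|exact: sqint_mulI|exact/(sqint_mulI mD _ G2)/sqintZ].
  by apply: eq_Rintegral => x _; rewrite !cE; ring.
apply/esym/cvg_lim => //.
apply: cvg_series_eq (limnD_parseval F2 G1 (sqintZ mD (-1) F1) G2) => n.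
by rewrite ImM ReJ ImJ !Re_coef !Im_coef ipZ//; ring.
Qed.

Section Multiplication.
Variables (h : T -> R) (B : R).
Hypothesis mh : measurable_fun D h.
Hypothesis hB : forall x, D x -> `|h x| <= B.
Let B0 x : D x -> 0 <= B.
Proof. by move=> /hB; apply: le_trans. Qed.

Lemma sqintM f : sqint f -> sqint (fun x => h x * f x).
Proof.
move=> [mf f2]; have mhf := measurable_funM mh mf; split => //.
apply: (@le_mul_integrable _ _ _ mu D mD _ (fun x => B ^+ 2 * f x ^+ 2)).
- exact: measurable_funX.
- move=> x Dx; rewrite normrX normrM exprMn ler_pM ?sqr_ge0//.
    by rewrite lerXn2r ?nnegrE ?hB//; exact: B0 Dx.
  by rewrite real_normK ?num_real.
- rewrite (_ : _ \o _ = (fun x => (B ^+ 2)%:E * (f x ^+ 2)%:E)%E)//.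
  exact: integrableZl.
Qed.

Lemma ip_mulh f g : ip (fun x => h x * f x) g = ip f (fun x => h x * g x).
Proof. by apply: eq_Rintegral => x _; ring. Qed.

Lemma ip_mulh_le f : sqint f ->
  ip (fun x => h x * f x) (fun x => h x * f x) <= B ^+ 2 * ip f f.
Proof.
move=> sf; rewrite !ipE -RintegralZl//; last exact: sqint_mulI.
apply: le_Rintegral => //.
- by apply: sqint_mulI => //; exact: sqintM.
- rewrite (_ : _ \o _ = (fun x => (B ^+ 2)%:E * (f x * f x)%:E)%E)//.
  by apply: integrableZl => //; exact: sqint_mulI.
- move=> x Dx; rewrite mulrACA -!expr2 ler_wpM2r ?sqr_ge0//.
  rewrite -real_normK ?num_real// lerXn2r ?nnegrE ?hB//.
  exact: B0 Dx.
Qed.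

Lemma L2_mulh F : L2 mu D F -> L2 mu D (fun x => (h x)%:C * F x).
Proof.
move=> /L2P[F1 F2]; apply/L2P; split.
  by under eq_fun do rewrite !cE mul0r subr0; exact: sqintM.
by under eq_fun do rewrite !cE mul0r addr0; exact: sqintM.
Qed.

Lemma normL2sq_mulh F : L2 mu D F ->
  normL2sq (fun x => (h x)%:C * F x) <= B ^+ 2 * normL2sq F.
Proof.
move=> /L2P[F1 F2]; rewrite mulrDr lerD//.
  by under [X in ip X _]eq_fun do rewrite !cE mul0r subr0;
     under [X in ip _ X]eq_fun do rewrite !cE mul0r subr0; exact: ip_mulh_le.
by under [X in ip X _]eq_fun do rewrite !cE mul0r addr0;
   under [X in ip _ X]eq_fun do rewrite !cE mul0r addr0; exact: ip_mulh_le.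
Qed.

Variable M : nat -> nat -> R.
Hypothesis ME : forall m n, M m n = ip (fun x => h x * phi m x) (phi n).

(** Row m of the matrix lists the Fourier coefficients of h phi_m, so Parseval's
    identity evaluates entry m of the product as <h phi_m, F> = <phi_m, h F>. *)
Lemma mat_apply_coef F : L2 mu D F ->
  mat_apply M (coef F) = coef (fun x => (h x)%:C * F x).
Proof.
move=> /L2P[F1 F2]; apply/funext => m; apply: complex_eqP; rewrite [RHS]/=.
  apply/cvg_lim => //.
  under [X in ip X _]eq_fun do rewrite !cE mul0r subr0.
  rewrite ip_mulh ipC.
  apply: cvg_series_eq (parseval mD sphi ophi total (sqintM (sphi m)) F1) => n.
  by rewrite !cE mul0r subr0/= ME.
apply/cvg_lim => //.
under [X in ip X _]eq_fun do rewrite !cE mul0r addr0.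
rewrite ip_mulh ipC.
apply: cvg_series_eq (parseval mD sphi ophi total (sqintM (sphi m)) F2) => n.
by rewrite !cE mul0r addr0/= ME.
Qed.

End Multiplication.
End ComplexL2.

(** * Diagonalization of the matrix of a multiplication operator *)

Section Diagonalization.
Context {d : measure_display} {T : measurableType d} {R : realType}.
Variables (mu : {measure set T -> \bar R}) (D : set T).
Hypothesis mD : measurable D.
Variable phi : nat -> T -> R.
Hypothesis sphi : forall n, sqint mu D (phi n).
Hypothesis ophi : forall m n, ip mu D (phi m) (phi n) = (m == n)%:R.
Hypothesis total : forall f, sqint mu D f -> (forall n, ip mu D f (phi n) = 0) ->
  {ae mu, forall x, D x -> f x = 0}.
Variables (h : T -> R) (B : R).
Hypothesis mh : measurable_fun D h.
Hypothesis B0 : 0 <= B.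
Hypothesis hB : forall x, D x -> `|h x| <= B.
Variable M : nat -> nat -> R.
Hypothesis ME : forall m n, M m n = ip mu D (fun x => h x * phi m x) (phi n).

Local Notation C := R[i].
Local Notation L2 := (L2 mu D).
Local Notation L2_eq := (L2_eq mu D).
Local Notation coef := (coef mu D phi).

(** A choice of one function for each square-summable sequence of coefficients. It is
    linear only up to [L2_eq]. *)
Lemma synthesis_exists : exists U : (nat -> C) -> (T -> C),
  forall z, ell2 z -> L2 (U z) /\ coef (U z) = z.
Proof.
have /choice[V VP] : forall c : nat -> R, exists f, cvgn (series (fun k => c k ^+ 2)) ->
    sqint mu D f /\ forall n, ip mu D f (phi n) = c n.
  move=> c; have [cc|ncc] := pselect (cvgn (series (fun k => c k ^+ 2))).
    by have [f [sf fc _]] := fourier_series_exists mD sphi ophi cc; exists f.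
  by exists (fun=> 0).
exists (fun z t => V (fun n => complex.Re (z n)) t +i* V (fun n => complex.Im (z n)) t).
move=> z /ell2P[/VP[s1 c1] /VP[s2 c2]]; split; first by apply/L2P.
by apply/funext => n; apply: complex_eqP; [exact: c1|exact: c2].
Qed.

Lemma L2_real f : sqint mu D f -> L2 (fun x => (f x)%:C).
Proof. by move=> sf; apply/L2P => //; split => //; exact: sqint0. Qed.

Lemma coef_real f : coef (fun x => (f x)%:C) = fun n => (ip mu D f (phi n))%:C.
Proof.
apply/funext => n; apply: complex_eqP => //=.
by rewrite -[RHS](ip0l mu D (phi n)).
Qed.

Section Synthesis.
Variable U : (nat -> C) -> (T -> C).
Hypothesis UP : forall z, ell2 z -> L2 (U z) /\ coef (U z) = z.

Let UL2 z : ell2 z -> L2 (U z). Proof. by move=> /UP[]. Qed.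
Let Ucoef z : ell2 z -> coef (U z) = z. Proof. by move=> /UP[]. Qed.

Lemma ell2_lin a (z w : nat -> C) : ell2 z -> ell2 w -> ell2 (fun n => a * z n + w n).
Proof.
move=> ez ew; rewrite -(Ucoef ez) -(Ucoef ew) -(coef_lin mD sphi)//; try exact: UL2.
by apply: (ell2_coef mD sphi ophi); apply: L2_lin => //; exact: UL2.
Qed.

Lemma ell2_sub (z w : nat -> C) : ell2 z -> ell2 w -> ell2 (z \- w).
Proof.
move=> ez ew; have := @ell2_lin (-1) _ _ ew ez.
by congr (ell2 _); apply/funext => n /=; rewrite mulN1r addrC.
Qed.

Lemma mat_apply_ell2 z : ell2 z -> mat_apply M z = coef (fun x => (h x)%:C * U z x).
Proof.
move=> ez; have := mat_apply_coef mD sphi ophi total mh hB ME (UL2 ez).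
by rewrite Ucoef.
Qed.

Lemma ell2_mat_apply z : ell2 z -> ell2 (mat_apply M z).
Proof.
move=> ez; rewrite mat_apply_ell2//; apply: (ell2_coef mD sphi ophi).
exact: (L2_mulh mD mh hB (UL2 ez)).
Qed.

Lemma ell2_norm_mat_apply z : ell2 z -> ell2_norm (mat_apply M z) <= B * ell2_norm z.
Proof.
move=> ez; have Lz := UL2 ez; have Lh := L2_mulh mD mh hB Lz.
rewrite mat_apply_ell2// (ell2_norm_coef mD sphi ophi total Lh).
rewrite -{2}(Ucoef ez) (ell2_norm_coef mD sphi ophi total Lz).
rewrite -[B]ger0_norm// -sqrtr_sqr -sqrtrM ?sqr_ge0// ler_wsqrtr//.
exact: (normL2sq_mulh mD mh hB Lz).
Qed.

Lemma mat_applyB z w : ell2 z -> ell2 w ->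
  mat_apply M (z \- w) = mat_apply M z \- mat_apply M w.
Proof.
move=> ez ew; have Lz := UL2 ez; have Lw := UL2 ew.
rewrite (mat_apply_ell2 ez) (mat_apply_ell2 ew).
rewrite (_ : z \- w = coef (fun x => -1 * U w x + U z x)); last first.
  by rewrite (coef_lin mD sphi)// !Ucoef//; apply/funext => n /=; rewrite mulN1r addrC.
rewrite (mat_apply_coef mD sphi ophi total mh hB ME); last exact: L2_lin.
rewrite (_ : (fun x => _) = (fun x => -1 * ((h x)%:C * U w x) + (h x)%:C * U z x)); last first.
  by apply/funext => x; rewrite mulrDr mulrCA.
rewrite (coef_lin mD sphi)//; try exact: (L2_mulh mD mh hB (UL2 _)).
by apply/funext => n /=; rewrite mulN1r addrC.
Qed.

(** If u_k -> x and M u_k -> y, boundedness gives M u_k -> M x, and comparing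
    coordinates y = M x. Conversely the truncations of x are finite combinations of
    basis vectors that converge to x, and so do their images by boundedness. *)
Lemma determines_unique : determines_unique_selfadjoint M.
Proof.
split.
- by move=> m n; rewrite !ME ip_mulh ipC.
- move=> n; rewrite (_ : (fun m => _) = coef (fun x => (h x * phi n x)%:C)).
    by apply: (ell2_coef mD sphi ophi); apply: L2_real; exact: (sqintM mD mh hB).
  by rewrite coef_real; apply/funext => m; rewrite ME ip_mulh ipC.
apply/seteqP; split => -[x y] /=.
- move=> [/= ex ey [u [v [Tuv ux vy]]]]; split => //=.
  apply/funext => m; apply/eqP; rewrite -subr_eq0; apply/eqP/Normc.eq0_normc.
  have eu k : ell2 (u k) by have [/= + _] := Tuv k; exact: ell2_span.
  have vE k : v k = mat_apply M (u k) by have [] := Tuv k.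
  apply/eqP; rewrite eq_le normc_ge0 andbT.
  have lim0 : ell2_norm (v k \- y) + B * ell2_norm (u k \- x) @[k --> \oo] --> (0 : R).
    rewrite -[X in _ --> X](addr0 0) -{2}(mulr0 B).
    by apply: cvgD => //; apply: cvgM => //; exact: cvg_cst.
  rewrite -(cvg_lim _ lim0)//; apply: limr_ge; first by apply/cvg_ex; exists 0.
  apply: nearW => k.
  have -> : y m - mat_apply M x m =
      - (v k m - y m) + mat_apply M (u k \- x) m.
    by rewrite mat_applyB//= vE; ring.
  apply: le_trans (le_normcD _ _) _; apply: lerD.
    rewrite normcN; apply: (normc_le_ell2_norm m (ell2_sub _ ey)).
    by rewrite vE; exact: ell2_mat_apply.
  apply: le_trans (ell2_norm_mat_apply (ell2_sub (eu k) ex)).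
  exact/normc_le_ell2_norm/ell2_mat_apply/ell2_sub.
- move=> [/= ex ey yE]; split => //=.
  exists (truncate x), (fun k => mat_apply M (truncate x k)).
  have et k : ell2 (truncate x k) by apply/ell2_span/span_truncate.
  split; [by move=> k; split => //; exact: span_truncate|exact: ell2_norm_truncate|].
  apply: (@squeeze_cvgr _ _ _ _ (fun=> 0) (fun k => B * ell2_norm (truncate x k \- x))).
  + apply: nearW => k; rewrite sqrtr_ge0/= yE -mat_applyB//.
    exact/ell2_norm_mat_apply/ell2_sub.
  + exact: cvg_cst.
  + rewrite -[X in _ --> X](mulr0 B); apply: cvgM; first exact: cvg_cst.
    exact: ell2_norm_truncate.
Qed.

(** Each property compares functions that have the same coefficients. *)
Lemma synthesis_unitary : unitary_ell2_L2 mu D U.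
Proof.
split.
- exact: UL2.
- move=> a z w ez ew; have ezw := @ell2_lin a _ _ ez ew.
  apply: (coef_injC mD sphi total); [exact: UL2|by apply: L2_lin => //; exact: UL2|].
  by rewrite (coef_lin mD sphi)// ?Ucoef//; exact: UL2.
- move=> z w ez ew.
  by rewrite (L2_inner_coef mD sphi ophi total)// ?Ucoef//; exact: UL2.
- move=> F LF; have eF := ell2_coef mD sphi ophi LF; exists (coef F) => //.
  by apply: (coef_injC mD sphi total) => //; [exact: UL2|rewrite Ucoef].
Qed.

Lemma synthesis_ebasis n : L2_eq (U (ebasis R n)) (fun x => (phi n x)%:C).
Proof.
have c : coef (fun x => (phi n x)%:C) = ebasis R n.
  rewrite coef_real; apply/funext => m; rewrite ophi /ebasis eq_sym.
  by case: eqP.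
have e : ell2 (ebasis R n) by rewrite -c; apply: (ell2_coef mD sphi ophi); exact: L2_real.
by apply: (coef_injC mD sphi total); [exact: UL2|exact: L2_real|rewrite Ucoef].
Qed.

(** Both graphs are determined by coefficients, on which the multiplication by h
    acts as the matrix. *)
Lemma conj_operator_mult : conj_operator mu D U (A_max M) = mult_operator mu D h.
Proof.
apply/seteqP; split => -[F G] /=.
- move=> [/= LF LG [x [y [[/= ex ey yE] xF yG]]]].
  have LhF := L2_mulh mD mh hB LF; split => //=.
  apply: L2_eq_trans (L2_eq_sym yG) _.
  apply: (coef_injC mD sphi total) => //; first exact: UL2.
  rewrite Ucoef// yE -(mat_apply_coef mD sphi ophi total mh hB ME)//.
  by rewrite -(coef_ae mD sphi (UL2 ex) LF xF) Ucoef.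
- move=> [/= LF LhF LG GhF]; split => //=.
  have eF := ell2_coef mD sphi ophi LF; have eG := ell2_coef mD sphi ophi LG.
  exists (coef F), (coef G); split.
  + split => //=; rewrite (mat_apply_coef mD sphi ophi total mh hB ME)//.
    exact: (coef_ae mD sphi).
  + by apply: (coef_injC mD sphi total) => //; [exact: UL2|rewrite Ucoef].
  + by apply: (coef_injC mD sphi total) => //; [exact: UL2|rewrite Ucoef].
Qed.

End Synthesis.

Theorem diagonalization :
  determines_unique_selfadjoint M /\
  exists U : (nat -> C) -> (T -> C),
    [/\ unitary_ell2_L2 mu D U,
        forall n, L2_eq (U (ebasis R n)) (fun x => (phi n x)%:C) &
        conj_operator mu D U (A_max M) = mult_operator mu D h].
Proof.
have [U UP] := synthesis_exists; split; first exact: determines_unique UP.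
exists U; split; [exact: synthesis_unitary|exact: synthesis_ebasis|].
exact: conj_operator_mult.
Qed.

End Diagonalization.

(** * Polynomials against Gaussian weights on the half line *)

Section GaussianIntegrals.
Variable R : realType.
Local Notation leb := (@lebesgue_measure R).
Local Notation D := (`]0, +oo[%classic : set R).

Definition gauss c (x : R) := expR (- (c * x ^+ 2)).

Lemma gauss_ge0 c x : 0 <= gauss c x. Proof. exact: expR_ge0. Qed.

Lemma gaussD a b x : gauss (a + b) x = gauss a x * gauss b x.
Proof. by rewrite /gauss -expRD; congr expR; ring. Qed.

Lemma continuous_gauss c : continuous (gauss c).
Proof.
move=> x; apply: continuous_comp; last exact: continuous_expR.
apply: cvgN; apply: cvgM; [exact: cvg_cst|exact: exprn_continuous].
Qed.

Lemma continuous_gauss_poly c (p : {poly R}) : continuous (fun x => p.[x] * gauss c x).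
Proof. by move=> x; apply: cvgM; [exact: continuous_horner|exact: continuous_gauss]. Qed.

Lemma measurable_gauss_poly c (p : {poly R}) (A : set R) :
  measurable_fun A (fun x => p.[x] * gauss c x).
Proof.
by apply: measurable_funTS; apply: continuous_measurable_fun; exact: continuous_gauss_poly.
Qed.

Lemma measurable_gauss c (A : set R) : measurable_fun A (gauss c).
Proof. by apply: measurable_funTS; apply: continuous_measurable_fun; exact: continuous_gauss. Qed.

(** The integral of e^(-y^2) over the half line, after the substitution
    y = sqrt(c) x. *)
Lemma integral_gauss c : 0 < c ->
  (\int[leb]_(x in D) (gauss c x)%:E = (Num.sqrt pi / 2 / Num.sqrt c)%:E)%E.
Proof.
move=> c0; have s0 : 0 < Num.sqrt c by rewrite sqrtr_gt0.
set s := Num.sqrt c in s0 *.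
pose F x := s * x.
have dF x : derivable F x 1 by [].
have F'E : (F^`()%classic) = cst s.
  by apply/funext => x; rewrite /F derive1E deriveM// derive_cst derive_id scaler0 addr0 scaler1.
have := @increasing_ge0_integration_by_substitutiony R F gauss_fun 0.
rewrite (_ : F 0 = 0) ?integral0y_gauss; last exact: mulr0.
move=> H.
have -> : (Num.sqrt pi / 2 / s)%:E = (s^-1%:E * (Num.sqrt pi / 2)%:E)%E :> \bar R.
  by rewrite -EFinM mulrC.
rewrite H ?F'E; first last.
- by move=> x _; exact: gauss_fun_ge0.
- by apply: continuous_subspaceT; exact: continuous_gauss_fun.
- by apply: gt0_cvgMry => //; exact: cvg_id.
- split; first by move=> x _.
  apply: cvg_at_right_filter; apply: cvgM; [exact: cvg_cst|exact: cvg_id].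
- exact: is_cvg_cst.
- exact: is_cvg_cst.
- by move=> x _; exact: cvg_cst.
- by move=> x y _ _ xy; rewrite /F ltr_pM2l.
rewrite -integral_itv_obnd_cbnd; last first.
  apply/measurable_EFinP; apply: measurable_funM => //.
  apply: measurable_funTS; apply: measurableT_comp; first exact: measurable_gauss_fun.
  exact: measurable_funM.
rewrite -ge0_integralZl_EFin//.
- apply: eq_integral => x _; rewrite -EFinM; congr EFin.
  rewrite [RHS](_ : _ = s^-1 * (expR (- (s * x) ^+ 2) * s))// /gauss exprMn sqr_sqrtr ?ltW//.
  by field; rewrite gt_eqF.
- by move=> x _; rewrite lee_fin mulr_ge0 ?gauss_fun_ge0// ltW.
- apply/measurable_EFinP; apply: measurable_funM => //.
  apply: measurable_funTS; apply: measurableT_comp; first exact: measurable_gauss_fun.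
  exact: measurable_funM.
- by rewrite invr_ge0 ltW.
Qed.

Lemma integrable_gauss c : 0 < c -> leb.-integrable D (EFin \o gauss c).
Proof.
move=> c0; apply/integrableP; split; first by apply/measurable_EFinP; exact: measurable_gauss.
under eq_integral do rewrite /= ger0_norm ?gauss_ge0//.
by rewrite integral_gauss// ltry.
Qed.

(** Induction on the degree: each factor x is absorbed by half of the exponent that is
    left, as |x| <= 1 + x^2 and e^t >= 1 + t. *)
Lemma poly_bound (p : {poly R}) : forall a, 0 < a ->
  exists2 K, 0 <= K & forall x, `|p.[x]| * gauss a x <= K.
Proof.
elim/poly_ind: p => [|p c IH] a a0.
  by exists 0 => // x; rewrite horner0 normr0 mul0r.
have a20 : 0 < a / 2 by rewrite divr_gt0.
have [K K0 KP] := IH _ a20; exists (K * (1 + 2 / a) + `|c|).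
  by rewrite addr_ge0 ?mulr_ge0 ?addr_ge0 ?divr_ge0// ltW.
move=> x; rewrite hornerD hornerMX hornerC.
have g1 : gauss a x <= 1.
  by rewrite /gauss -expR0 ler_expR oppr_le0 mulr_ge0 ?sqr_ge0// ltW.
have xg : `|x| * gauss (a / 2) x <= 1 + 2 / a.
  rewrite /gauss expRN ler_pdivrMr ?expR_gt0//.
  have := expR_ge1Dx (a / 2 * x ^+ 2).
  set E := expR _ => HE.
  have H1 : `|x| <= 1 + `|x| ^+ 2 by have := sqr_ge0 (`|x| - 1); have := normr_ge0 x; nra.
  apply: le_trans H1 _; rewrite real_normK ?num_real//.
  have H2 : 0 <= x ^+ 2 := sqr_ge0 x.
  apply: (@le_trans _ _ ((1 + 2 / a) * (1 + a / 2 * x ^+ 2))); last first.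
    by have a0' := ltW a0; rewrite ler_wpM2l// addr_ge0// mulr_ge0// invr_ge0.
  have -> : (1 + 2 / a) * (1 + a / 2 * x ^+ 2) = 1 + x ^+ 2 + (2 / a + a / 2 * x ^+ 2).
    by field; rewrite gt_eqF.
  rewrite lerDl; apply: addr_ge0; [by rewrite divr_ge0// ltW|].
  by rewrite mulr_ge0// divr_ge0// ltW.
apply: le_trans (ler_wpM2r (gauss_ge0 _ _) (ler_normD _ _)) _.
rewrite mulrDl lerD//; last by rewrite ler_piMr.
rewrite normrM {1}[a]splitr gaussD mulrACA ler_pM ?mulr_ge0 ?gauss_ge0//.
Qed.

Lemma integrable_gauss_poly c (p : {poly R}) : 0 < c ->
  leb.-integrable D (EFin \o (fun x => p.[x] * gauss c x)).
Proof.
move=> c0; have c20 : 0 < c / 2 by rewrite divr_gt0.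
have [K K0 KP] := poly_bound p c20.
have mD : measurable D by [].
apply: (@le_mul_integrable _ _ _ leb D mD _ (fun x => K * gauss (c / 2) x)) => //.
- exact: measurable_gauss_poly.
- move=> x _; rewrite {1}[c]splitr gaussD mulrA normrM ler_pM//.
    by rewrite normrM [X in _ * X]ger0_norm ?gauss_ge0.
  by rewrite ger0_norm ?gauss_ge0.
- rewrite (_ : _ \o _ = (fun x => K%:E * (gauss (c / 2) x)%:E)%E)//.
  by apply: integrableZl => //; exact: integrable_gauss.
Qed.

Definition poly_gauss_int c (p : {poly R}) : R := \int[leb]_(x in D) (p.[x] * gauss c x).

Lemma poly_gauss_intD c p q : 0 < c ->
  poly_gauss_int c (p + q) = poly_gauss_int c p + poly_gauss_int c q.
Proof.
move=> c0; rewrite /poly_gauss_int -RintegralD//; [|exact: integrable_gauss_poly..].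
by apply: eq_Rintegral => x _; rewrite hornerD mulrDl.
Qed.

Lemma poly_gauss_intZ c a p : 0 < c -> poly_gauss_int c (a *: p) = a * poly_gauss_int c p.
Proof.
move=> c0; rewrite /poly_gauss_int -RintegralZl//; last exact: integrable_gauss_poly.
by apply: eq_Rintegral => x _; rewrite hornerZ mulrA.
Qed.

Lemma poly_gauss_intB c p q : 0 < c ->
  poly_gauss_int c (p - q) = poly_gauss_int c p - poly_gauss_int c q.
Proof. by move=> c0; rewrite -scaleN1r poly_gauss_intD// poly_gauss_intZ// mulN1r. Qed.

Lemma poly_gauss_int1 c : 0 < c -> poly_gauss_int c 1 = Num.sqrt pi / 2 / Num.sqrt c.
Proof.
move=> c0; rewrite /poly_gauss_int /Rintegral.
under eq_integral do rewrite hornerC mul1r.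
by rewrite integral_gauss.
Qed.

Lemma cvg_gauss_poly0 c (p : {poly R}) : 0 < c ->
  p.[n%:R] * gauss c n%:R @[n --> \oo] --> (0 : R).
Proof.
move=> c0; have c20 : 0 < c / 2 by rewrite divr_gt0.
have [K K0 KP] := poly_bound p c20.
have g0 : gauss (c / 2) n%:R @[n --> \oo] --> (0 : R).
  apply: (cvg_comp (fun n => n%:R) (gauss (c / 2))); first exact: cvgr_idn.
  apply: (cvg_comp (fun x => c / 2 * x ^+ 2) (fun x => expR (- x))).
    by apply: gt0_cvgMry => //; exact: cvgr_expr2.
  exact: cvgr_expR.
apply/norm_cvg0P; apply: (@squeeze_cvgr _ _ _ _ (fun=> 0) (fun n => K * gauss (c / 2) n%:R)).
- apply: nearW => n; rewrite normr_ge0/= {1}[c]splitr gaussD mulrA normrM ler_pM//.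
    by rewrite normrM [X in _ * X]ger0_norm ?gauss_ge0.
  by rewrite ger0_norm ?gauss_ge0.
- exact: cvg_cst.
- by rewrite -[X in _ --> X](mulr0 K); apply: cvgM => //; exact: cvg_cst.
Qed.

Lemma is_derive_gauss_poly c (p : {poly R}) (x : R) :
  is_derive x 1 (fun x => p.[x] * gauss c x)
    ((p^`() - (2 * c) *: ('X * p)).[x] * gauss c x).
Proof.
have dsq : is_derive x 1 (fun x => (- c%:P * 'X^2).[x]) (- c%:P * 'X^2)^`().[x].
  exact: is_derive_poly.
have dg : is_derive x 1 (gauss c) (gauss c x * (- (2 * c * x))).
  have -> : gauss c = expR \o (fun x => (- c%:P * 'X^2).[x]).
    by apply/funext => y; rewrite /gauss /= hornerM hornerN hornerC hornerXn mulNr.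
  have dc := @is_derive1_comp R expR (fun x => (- c%:P * 'X^2).[x]) x _ _ (is_derive_expR _) dsq.
  apply: (is_derive_eq dc); congr (_ * _).
  rewrite derivM derivN derivC oppr0 mul0r add0r derivXn !hornerE/=.
  by rewrite /= ?hornerE; ring.
have dm := is_deriveM (is_derive_poly p x) dg; apply: (is_derive_eq dm).
by rewrite !hornerE/= /GRing.scale/=; ring.
Qed.

(** The integrand is the opposite of the derivative of p(x) e^(-c x^2), which vanishes
    at infinity and takes the value p(0) at 0. As it may change sign, the integral over
    the half line is obtained from those over ]0, n] by dominated convergence. *)
Lemma poly_gauss_int_parts c p : 0 < c -> poly_gauss_int c ((2 * c) *: ('X * p) - p^`()) = p.[0].
Proof.
move=> c0; pose g x := p.[x] * gauss c x.
pose q := p^`() - (2 * c) *: ('X * p); pose g' x := q.[x] * gauss c x.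
have iq := integrable_gauss_poly q c0.
suff : poly_gauss_int c q = - p.[0].
  move=> H; rewrite -[X in poly_gauss_int c X]opprB -scaleN1r.
  by rewrite poly_gauss_intZ// -/q H mulN1r opprK.
pose f_ n := EFin \o (g' \_ `]0, n%:R]).
have FTC n : (0 < n)%N -> (\int[leb]_(x in D) f_ n x = (g n%:R - g 0)%:E)%E.
  move=> n0; have n0' : 0 < n%:R :> R by rewrite ltr0n.
  rewrite EFinB -(@continuous_FTC2 R g' g 0 n%:R)//.
  - rewrite -[RHS]integral_itv_obnd_cbnd; last first.
      by apply/measurable_EFinP; exact: measurable_gauss_poly.
    rewrite [RHS]integral_mkcond [LHS]integral_mkcond.
    apply: eq_integral => x _; rewrite /f_ /patch /=.
    have [xn|xn] := pselect (`]0, n%:R]%classic x).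
      have Dx : D x by move: xn; rewrite /= !in_itv/= andbT => /andP[].
      by rewrite !mem_set.
    by rewrite (memNset xn); case: ifP.
  - by apply: continuous_subspaceT; exact: continuous_gauss_poly.
  - split; first by move=> x _; have [] := is_derive_gauss_poly c p x.
    + exact/cvg_at_right_filter/continuous_gauss_poly.
    + exact/cvg_at_left_filter/continuous_gauss_poly.
  - by move=> x _; rewrite derive1E; have [_ ->] := is_derive_gauss_poly c p x.
have l1 : (\int[leb]_(x in D) f_ n x)%E @[n --> \oo] --> (- p.[0])%:E.
  have : (g n%:R - g 0)%:E @[n --> \oo] --> (- p.[0])%:E.
    apply: cvg_EFin; first exact: nearW.
    rewrite -[X in _ --> X]add0r; apply: cvgB; first exact: cvg_gauss_poly0.
    by rewrite /g /gauss expr0n/= mulr0 oppr0 expR0 mulr1; exact: cvg_cst.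
  apply: cvg_trans; apply: near_eq_cvg; exists 1%N => // n /= n0.
  by rewrite FTC.
have mf_ n : measurable_fun D (f_ n).
  apply/measurable_EFinP; apply: measurable_funTS; apply/(measurable_restrictT _ _).1 => //.
  exact: measurable_gauss_poly.
have f_cvg : {ae leb, forall x, D x -> f_ ^~ x @ \oo --> (EFin \o g') x}.
  apply: aeW => x; rewrite /= in_itv/= andbT => x0; apply: cvg_near_cst.
  near=> n; rewrite /f_/= /patch mem_set//= in_itv/= x0/= ltW//.
  by near: n; exact: nbhs_infty_gtr.
have f_le : {ae leb, forall x n, D x -> (`|f_ n x| <= `|(g' x)%:E|)%E}.
  apply: aeW => x n _; rewrite /f_/= /patch; by case: ifPn => //; rewrite normr0 lee_fin.
have [_ _ l2] := @dominated_convergence _ _ R leb D (measurable_itv _) f_ (EFin \o g')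
  (fun x => `|(g' x)%:E|)%E mf_ (measurable_int _ iq)
  f_cvg (integrable_abse iq) f_le.
have := cvg_unique _ l1 l2; rewrite /poly_gauss_int /Rintegral => /(_ _)/= <- //.
Unshelve. all: by end_near. Qed.

End GaussianIntegrals.

(** * The Gamma function at half-integers *)

Section GammaHalfIntegers.
Variable R : realType.
Local Notation leb := (@lebesgue_measure R).
Local Notation D := (`]0, +oo[%classic : set R).

(** The p-th power map sends the n-th interval for the exponent 1 onto the n-th
    interval for the exponent p. *)
Definition compact_exhaustion (p n : nat) : set R :=
  `[(n.+1%:R^-1) ^+ p, n.+1%:R ^+ p]%classic.

Lemma compact_exhaustion_nd p : nondecreasing_seq (compact_exhaustion p).
Proof.
move=> m n mn; apply/subsetPset => x; rewrite /compact_exhaustion /= !in_itv/=.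
move=> /andP[xm mx]; apply/andP; split.
  apply: le_trans xm; rewrite lerXn2r ?nnegrE ?invr_ge0//.
  by rewrite lef_pV2 ?posrE ?ltr0n// ler_nat.
by apply: le_trans mx _; rewrite lerXn2r ?nnegrE// ler_nat.
Qed.

Lemma bigcup_compact_exhaustion p : (0 < p)%N ->
  \bigcup_n compact_exhaustion p n = D.
Proof.
move=> p0; apply/seteqP; split => x; rewrite /compact_exhaustion /= ?in_itv/=.
  move=> [n _] /=; rewrite !in_itv/= andbT => /andP[+ _]; apply: lt_le_trans.
  by rewrite exprn_gt0// invr_gt0.
rewrite andbT => x0.
have [n xn] : exists n : nat, x + x^-1 < n.+1%:R.
  exists (Num.truncn (x + x^-1)); exact: truncnS_gt.
exists n => //=; rewrite in_itv/=.
have n1 : 1 <= n.+1%:R :> R by rewrite ler1n.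
have le1 : n.+1%:R <= n.+1%:R ^+ p :> R by rewrite ler_eXnr.
have xV : 0 < x^-1 by rewrite invr_gt0.
apply/andP; split; last by apply: le_trans le1; lra.
rewrite exprVn -[leRHS]invrK lef_pV2 ?posrE ?exprn_gt0//.
by apply: le_trans le1; lra.
Qed.

(** The substitution t = x^2. It is made on compact subintervals of the open half
    line, because Euler's integrand may be unbounded at 0 and 2x is unbounded at
    infinity; monotone convergence concludes. *)
Lemma Gamma_poly_gauss_int k : Gamma (k%:R + 1 / 2) = 2 * poly_gauss_int 1 ('X^(2 * k) : {poly R}).
Proof.
rewrite /poly_gauss_int -RintegralZl//; last exact: integrable_gauss_poly.
rewrite /Gamma /Rintegral; congr fine.
pose G (t : R) := t `^ (k%:R + 1 / 2 - 1) * expR (- t).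
pose H (x : R) := 2 * (('X^(2 * k) : {poly R}).[x] * gauss 1 x).
have cG : {in D, continuous G}.
  move=> t; rewrite inE/= in_itv/= andbT => t0; apply: cvgM.
    have [d _] := is_derive1_powR (k%:R + 1 / 2 - 1) t0.
    by move: d => /derivable1_diffP/differentiable_continuous.
  by apply: continuous_comp; [exact: continuousN|exact: continuous_expR].
have mG : measurable_fun D G.
  apply: measurable_funM; first by apply: measurable_funTS; exact: measurable_powR.
  by apply: measurableT_comp => //; exact: measurableT_comp.
have mH : measurable_fun setT H.
  by apply: measurable_funM => //; exact: measurable_gauss_poly.
have G0 t : 0 <= G t by rewrite mulr_ge0 ?powR_ge0 ?expR_ge0.
have H0 x : 0 <= H x.
  by rewrite mulr_ge0// mulr_ge0 ?gauss_ge0// hornerXn exprM exprn_ge0 ?sqr_ge0.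
have subD p n : (0 < p)%N -> compact_exhaustion p n `<=` D.
  by move=> p0; rewrite -(bigcup_compact_exhaustion p0); exact: bigcup_sup.
have l1 : (\int[leb]_(t in compact_exhaustion 2 n) (G t)%:E)%E @[n --> \oo] -->
    (\int[leb]_(t in D) (G t)%:E)%E.
  rewrite -(@bigcup_compact_exhaustion 2)//.
  apply: ge0_nondecreasing_set_cvg_integral => //.
  - exact: compact_exhaustion_nd.
  - by move=> n; exact: measurable_itv.
  - by move=> n; apply/measurable_EFinP; apply: measurable_funS mG => //; exact: subD.
  - by move=> n x _; rewrite lee_fin.
have l2 : (\int[leb]_(t in compact_exhaustion 1 n) (H t)%:E)%E @[n --> \oo] -->
    (\int[leb]_(t in D) (H t)%:E)%E.
  rewrite -(@bigcup_compact_exhaustion 1)//.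
  apply: ge0_nondecreasing_set_cvg_integral => //.
  - exact: compact_exhaustion_nd.
  - by move=> n; exact: measurable_itv.
  - by move=> n; apply/measurable_EFinP; exact: measurable_funTS.
  - by move=> n x _; rewrite lee_fin.
apply: cvg_unique l2 => //; apply: cvg_trans l1; apply: near_eq_cvg; apply: nearW => n.
pose F (x : R) := ('X^2 : {poly R}).[x].
have dF (x : R) : is_derive x 1 F (2 * x).
  by apply: (is_derive_eq (is_derive_poly _ _)); rewrite derivXn /= !hornerE; ring.
have F'E : F^`()%classic = fun x => 2 * x.
  by apply/funext => x; rewrite derive1E; have [_ ->] := dF x.
have cF' (x : R) : 2 * x @[x --> x] --> 2 * x.
  by apply: cvgM; [exact: cvg_cst|exact: cvg_id].
have cF (x : R) : F x @[x --> x] --> F x by exact: continuous_horner.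
pose a : R := n.+1%:R^-1; pose b : R := n.+1%:R.
have a0 : 0 < a by rewrite invr_gt0.
have ab : a <= b.
  by rewrite /a /b (@le_trans _ _ 1) ?invf_le1 ?ler1n.
rewrite /compact_exhaustion !expr1.
have FE x : F x = x ^+ 2 by rewrite /F hornerXn.
rewrite -!FE (@integration_by_substitution_increasing R F G a b)//; first last.
- apply: continuous_in_subspaceT => x xF; apply: cG.
  move: xF; rewrite !inE/= !in_itv/= andbT => /andP[+ _].
  by apply: lt_le_trans; rewrite FE exprn_gt0.
- split; first by move=> x _; have [] := dF x.
  + exact/cvg_at_right_filter/cF.
  + exact/cvg_at_left_filter/cF.
- by rewrite F'E; apply/cvg_ex; exists (2 * b); exact/cvg_at_left_filter/cF'.
- by rewrite F'E; apply/cvg_ex; exists (2 * a); exact/cvg_at_right_filter/cF'.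
- by rewrite F'E => x _; exact: cF'.
- move=> x y; rewrite !in_itv/= => /andP[ax _] /andP[ay _] xy; rewrite !FE.
  by rewrite ltrXn2r ?nnegrE ?(le_trans (ltW a0)).
apply: eq_integral => x; rewrite inE/= in_itv/= => /andP[ax _].
have x0 : 0 < x by exact: lt_le_trans ax.
congr EFin; rewrite F'E /H /gauss mul1r hornerXn.
rewrite [RHS](_ : _ = G (F x) * (2 * x))// /G FE.
rewrite [X in _ = X * _ * _](_ : _ = x ^+ (2 * k) / x); last first.
  rewrite -powR_mulrn ?ltW// -powRrM (_ : _ * _ = (2 * k)%:R - 1); last first.
    by rewrite natrM; field.
  rewrite powRD; last by rewrite (gt_eqF x0) implybT.
  rewrite powR_mulrn ?ltW//.
  by rewrite powRN powRr1// ltW.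
by field; rewrite gt_eqF.
Qed.

End GammaHalfIntegers.

(** * Integration against the half-line Gaussian measure *)

Section HalfLineMeasure.
Variable R : realType.
Local Notation leb := (@lebesgue_measure R).
Local Notation D := (`]0, +oo[%classic : set R).
Local Notation rho := (@mu_density R).

Lemma mu_densityE : rho = fun x => (Num.sqrt pi)^-1 * gauss 1 x.
Proof. by apply/funext => x; rewrite /mu_density /gauss mul1r. Qed.

Lemma integrable_mu_density : leb.-integrable D (EFin \o rho).
Proof.
rewrite mu_densityE (_ : _ \o _ = (fun x => (Num.sqrt pi)^-1%:E * (gauss 1 x)%:E)%E)//.
by apply: integrableZl => //; exact: integrable_gauss.
Qed.

Lemma mu_half_finite : (mu_half [set: measurableTypeR R] < +oo)%E.
Proof.
rewrite /mu_half setTI; have /integrableP[_] := integrable_mu_density.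
by under eq_integral do rewrite /= ger0_norm ?mu_density_ge0//.
Qed.

HB.instance Definition _ := @Measure_isFinite.Build _ _ _ (@mu_half R)
  (lty_fin_num_fun mu_half_finite).

(** Absolute continuity identifies the density of [mu_half] with its Radon-Nikodym
    derivative in [ge0_integral_mu_half]. *)
Lemma mu_half_dominates : @mu_half R `<< leb.
Proof.
apply/null_content_dominatesP => A mA A0; rewrite /mu_half.
apply: null_set_integral => //; first exact: measurableI.
- by apply/measurable_EFinP; exact: measurable_mu_density.
- by apply/eqP; rewrite -measure_le0 -A0 le_measure ?inE//; exact: measurableI.
Qed.

Lemma ge0_integral_mu_half (f : R -> \bar R) : (forall x, 0 <= f x)%E ->
  measurable_fun D f ->
  (\int[@mu_half R]_(x in D) f x = \int[leb]_(x in D) (f x * (rho x)%:E))%E.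
Proof.
move=> f0 mf; have mD : measurable D by exact: measurable_itv.
have nu_mu := mu_half_dominates.
have mrD : measurable_fun setT ((EFin \o rho) \_ D).
  apply/(measurable_restrictT _ _).1 => //.
  by apply/measurable_EFinP; exact: measurable_mu_density.
have gE : ae_eq leb setT (Radon_Nikodym_SigmaFinite.f (@mu_half R) leb) ((EFin \o rho) \_ D).
  apply: integral_ae_eq => //.
    exact: Radon_Nikodym_SigmaFinite.f_integrable.
  move=> E _ mE; rewrite -Radon_Nikodym_SigmaFinite.f_integral//.
  by rewrite /= /mu_half integral_mkcondr.
rewrite -(Radon_Nikodym_SigmaFinite.change_of_variables nu_mu)//.
apply: ge0_ae_eq_integral => //.
- apply: emeasurable_funM => //.
  by apply: measurable_funTS; exact: measurable_int (Radon_Nikodym_SigmaFinite.f_integrable nu_mu).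
- apply: emeasurable_funM => //; apply/measurable_EFinP; exact: measurable_mu_density.
- by move=> x _; rewrite mule_ge0// Radon_Nikodym_SigmaFinite.f_ge0.
- by move=> x _; rewrite mule_ge0// lee_fin mu_density_ge0.
- by apply: filterS gE => x /(_ I) -> Dx; rewrite patchE mem_set.
Qed.

Lemma integrable_mu_half (f : R -> R) : measurable_fun D f ->
  leb.-integrable D (EFin \o (fun x => f x * rho x)) ->
  (@mu_half R).-integrable D (EFin \o f).
Proof.
move=> mf /integrableP[_ fi]; apply/integrableP; split; first exact/measurable_EFinP.
have mf' : measurable_fun D (fun x => `|(f x)%:E|)%E.
  by apply: measurableT_comp => //; exact/measurable_EFinP.
apply: le_lt_trans fi; rewrite le_eqVlt; apply/orP; left; apply/eqP.
apply: etrans (ge0_integral_mu_half _ mf') _ => //.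
by apply: eq_integral => x _ /=; rewrite normrM [X in _ * X]ger0_norm ?mu_density_ge0.
Qed.

Lemma Rintegral_mu_half (f : R -> R) : measurable_fun D f ->
  leb.-integrable D (EFin \o (fun x => f x * rho x)) ->
  \int[@mu_half R]_(x in D) f x = \int[leb]_(x in D) (f x * rho x).
Proof.
move=> mf fi; rewrite /Rintegral; congr fine.
rewrite integralE [RHS]integralE; congr (_ - _)%E.
  rewrite ge0_integral_mu_half//.
    apply: eq_integral => x _; rewrite !funeposE -!EFin_max -EFinM; congr EFin.
    by rewrite maxr_pMl ?mu_density_ge0// mul0r.
  by apply: measurable_funepos; exact/measurable_EFinP.
rewrite ge0_integral_mu_half//.
  apply: eq_integral => x _; rewrite !funenegE -!EFinN -!EFin_max -EFinM; congr EFin.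
  by rewrite maxr_pMl ?mu_density_ge0// mul0r mulNr.
by apply: measurable_funeneg; exact/measurable_EFinP.
Qed.

Lemma integrable_mu_half_poly (p : {poly R}) c : c < 1 ->
  (@mu_half R).-integrable D (EFin \o (fun x => p.[x] * gauss (- c) x)).
Proof.
move=> c1; apply: integrable_mu_half; first exact: measurable_gauss_poly.
have := @integrable_gauss_poly R (1 - c) ((Num.sqrt pi)^-1 *: p).
rewrite subr_gt0 => /(_ c1); apply: eq_integrable => // x _ /=.
by rewrite hornerZ gaussD mu_densityE; congr EFin; ring.
Qed.

Lemma Rintegral_mu_half_gauss (p : {poly R}) c : -1 < c ->
  \int[@mu_half R]_(x in D) (p.[x] * gauss c x) = (Num.sqrt pi)^-1 * poly_gauss_int (1 + c) p.
Proof.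
move=> c1; have c0 : 0 < 1 + c by lra.
have ip := integrable_gauss_poly p c0.
rewrite Rintegral_mu_half; last 2 first.
- exact: measurable_gauss_poly.
- have := @integrable_gauss_poly R (1 + c) ((Num.sqrt pi)^-1 *: p) c0.
  apply: eq_integrable => // x _ /=.
  by rewrite hornerZ gaussD mu_densityE; congr EFin; ring.
rewrite /poly_gauss_int -RintegralZl//.
by apply: eq_Rintegral => x _; rewrite gaussD mu_densityE; ring.
Qed.

End HalfLineMeasure.

(** * Hermite polynomials *)

Section Hermite.
Variable R : realType.

(** Two consecutive Hermite polynomials, so that the three-term recurrence becomes a
    structural recursion. *)
Fixpoint hermite_pair n : {poly R} * {poly R} :=
  if n is m.+1 then
    let: (p, q) := hermite_pair m in (q, 2 *: ('X * q) - (2 * m.+1%:R) *: p)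
  else (1, 2 *: 'X).

Definition hermite_poly n := (hermite_pair n).1.
Local Notation H := hermite_poly.

Lemma hermite_polySS n : H n.+2 = 2 *: ('X * H n.+1) - (2 * n.+1%:R) *: H n.
Proof. by rewrite /hermite_poly/=; case: (hermite_pair n). Qed.

(** For n = 0 the coefficient is 0 and the truncated predecessor is harmless. *)
Lemma deriv_hermite_poly n : (H n)^`() = (2 * n%:R) *: H n.-1.
Proof.
elim/ltn_ind: n => -[_|[_|n IH]].
- by rewrite /hermite_poly/= derivC mulr0 scale0r.
- by rewrite /hermite_poly/= derivZ derivX mulr1.
rewrite hermite_polySS derivB !derivZ derivM derivX mul1r !IH//=.
rewrite -scalerAr; case: n IH => [|n] _.
  by rewrite /hermite_poly/= -!mul_polyC !polyCM !polyC_natr; ring.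
rewrite [H n.+2]hermite_polySS/= -!mul_polyC !polyCM !polyC_natr; ring.
Qed.

Lemma hermite_polyS n : H n.+1 = 2 *: ('X * H n) - (H n)^`().
Proof.
rewrite deriv_hermite_poly; case: n => [|n]; last exact: hermite_polySS.
by rewrite /hermite_poly/= mulr1 mulr0 scale0r subr0.
Qed.

Lemma hermite_poly_odd0 n : odd n -> (H n).[0] = 0.
Proof.
elim/ltn_ind: n => -[//|[_ _|n IH]].
  by rewrite /hermite_poly/= hornerZ hornerX mulr0.
rewrite /= negbK => on; rewrite hermite_polySS hornerD hornerN !hornerZ hornerM hornerX.
by rewrite (IH n)// mul0r !mulr0 subrr.
Qed.

(** One of the two factors is odd. This kills the boundary terms at 0. *)
Lemma hermite_polyM0 m n : odd m != odd n -> (H m * H n).[0] = 0.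
Proof.
rewrite hornerM; case: (boolP (odd m)) => [om _|_].
  by rewrite hermite_poly_odd0// mul0r.
by case: (boolP (odd n)) => // on _; rewrite (hermite_poly_odd0 on) mulr0.
Qed.

(** The terms of the explicit sum, extended by 0 so that the sums for n, n + 1 and
    n + 2 can be taken over a common range. *)
Definition hermite_term (x : R) n j : R :=
  if (j.*2 <= n)%N then
    n`!%:R * ((-1) ^+ j * (2 * x) ^+ (n - j.*2) / (j`!%:R * (n - j.*2)`!%:R))
  else 0.

Lemma hermite_termE (x : R) n K : (n./2 < K)%N ->
  hermite n x = \sum_(j < K) hermite_term x n j.
Proof.
move=> nK; rewrite /hermite big_mkord -(subnKC nK) big_split_ord/=.
rewrite [X in _ = _ + X]big1 ?addr0 => [|j _]; last first.
  rewrite /hermite_term ifF//; apply/negbTE; rewrite -ltnNge -ltn_half_double.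
  by rewrite (leq_trans (leqnn _))// addSn ltnS leq_addr.
rewrite mulr_sumr; apply: eq_bigr => j _; rewrite /hermite_term ifT//.
by rewrite -geq_half_double; rewrite -ltnS.
Qed.

Lemma hermite_term0 x n : hermite_term x n.+1 0 = 2 * x * hermite_term x n 0.
Proof.
have f0 k : k`!%:R != 0 :> R by rewrite pnatr_eq0 -lt0n fact_gt0.
have s0 : 1 + n%:R != 0 :> R by rewrite nat1r pnatr_eq0.
by rewrite /hermite_term/= !subn0 factS exprS natrM; field; rewrite !f0 s0.
Qed.

(** The three-term recurrence holds term by term: it reduces to
    n + 2 = (n - 2 j) + 2 (j + 1). *)
Lemma hermite_termSS x n j : hermite_term x n.+2 j.+1 =
  2 * x * hermite_term x n.+1 j.+1 - 2 * n.+1%:R * hermite_term x n j.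
Proof.
have f0 k : k`!%:R != 0 :> R by rewrite pnatr_eq0 -lt0n fact_gt0.
have s0 k : k%:R + 1 != 0 :> R by rewrite natr1 pnatr_eq0.
rewrite /hermite_term doubleS !ltnS.
have [jn|nj|jn] := ltngtP j.*2 n.
- have [k nE] : exists k, n = (k.+1 + j.*2)%N by exists (n - j.*2).-1; lia.
  have -> : (n.+2 - j.*2.+2)%N = k.+1 by lia.
  have -> : (n.+1 - j.*2.+2)%N = k by lia.
  have -> : (n - j.*2)%N = k.+1 by lia.
  have nR : n%:R = k%:R + 1 + 2 * j%:R :> R.
    by rewrite nE natrD -natr1 -muln2 natrM mulrC.
  rewrite !factS !exprS !natrM -![_.+2%:R]natr1 -![_.+1%:R]natr1 nR.
  by field; rewrite !f0 !s0.
- by rewrite !mulr0 subr0.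
- have -> : (n.+2 - j.*2.+2)%N = 0 by lia.
  have -> : (n - j.*2)%N = 0 by lia.
  have nR : n%:R = 2 * j%:R :> R by rewrite -jn -muln2 natrM mulrC.
  rewrite !factS !exprS !natrM -![_.+2%:R]natr1 -![_.+1%:R]natr1 nR.
  by rewrite mulr0; field; rewrite !f0 !s0.
Qed.

Lemma hermiteE n x : hermite n x = (H n).[x].
Proof.
elim/ltn_ind: n => -[_|[_|n IH]].
- rewrite (@hermite_termE _ _ 1)// big_ord1 /hermite_term/= /hermite_poly/=.
  by rewrite hornerC subn0 fact0; field.
- rewrite (@hermite_termE _ _ 1)// big_ord1 hermite_term0 /hermite_term/= /hermite_poly/=.
  by rewrite hornerZ hornerX subn0 fact0; field.
rewrite hermite_polySS hornerD hornerN !hornerZ hornerM hornerX -!IH//.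
rewrite (@hermite_termE _ _ n.+3); last by lia.
rewrite (@hermite_termE _ n.+1 n.+3); last by lia.
rewrite (@hermite_termE _ n n.+2); last by lia.
rewrite big_ord_recl hermite_term0 [X in 2 * (x * X)]big_ord_recl.
rewrite [2 * (x * (_ + _))]mulrA mulrDr -addrA; congr (_ + _).
rewrite !mulr_sumr -sumrB; apply: eq_bigr => j _.
exact: hermite_termSS.
Qed.

Local Notation c1 := (ltr01 : 0 < 1 :> R).
Local Notation c2 := (ltr0Sn R 1).

(** Integration by parts of p = H_m H_(n+1), where
    2 X p - p' = H_(m+1) H_(n+1) - H_m H_(n+1)'. *)
Lemma poly_gauss_int_hermite_rec1 m n : odd m = odd n ->
  poly_gauss_int 1 (H m.+1 * H n.+1) = 2 * n.+1%:R * poly_gauss_int 1 (H m * H n).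
Proof.
move=> mn; have := poly_gauss_int_parts (H m * H n.+1) c1.
rewrite hermite_polyM0 ?mn/=; last by case: (odd n).
have -> : (2 * 1) *: ('X * (H m * H n.+1)) - (H m * H n.+1)^`() =
    H m.+1 * H n.+1 - (2 * n.+1%:R) *: (H m * H n).
  rewrite [H m.+1]hermite_polyS derivM [(H n.+1)^`()]deriv_hermite_poly/=.
  by rewrite -!mul_polyC !polyCM !polyC_natr; ring.
by rewrite poly_gauss_intB// poly_gauss_intZ// => /eqP; rewrite subr_eq0 => /eqP.
Qed.

Lemma poly_gauss_int_hermite_rec10 m : odd m -> poly_gauss_int 1 (H m.+1 * H 0) = 0.
Proof.
move=> om; have := poly_gauss_int_parts (H m * H 0) c1.
rewrite hermite_polyM0 ?om//.
have -> : (2 * 1) *: ('X * (H m * H 0)) - (H m * H 0)^`() = H m.+1 * H 0.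
  rewrite [H m.+1]hermite_polyS derivM [(H 0)^`()]deriv_hermite_poly/= mulr0 scale0r.
  by rewrite -!mul_polyC !polyCM !polyC_natr; ring.
by [].
Qed.

Lemma poly_gauss_int_hermite_orthogonal m n : odd m = odd n ->
  poly_gauss_int 1 (H m * H n) = (m == n)%:R * (2 ^+ n * n`!%:R * (Num.sqrt pi / 2)).
Proof.
elim: m n => [|m IH] [|n] mn.
- by rewrite mulr1 poly_gauss_int1// sqrtr1 divr1 expr0 fact0 !mul1r.
- by rewrite mulrC poly_gauss_int_hermite_rec10 ?mul0r//; move: mn => /=; case: (odd n).
- by rewrite poly_gauss_int_hermite_rec10 ?mul0r//; move: mn => /=; case: (odd m).
have mn' : odd m = odd n by move: mn => /=; case: (odd m); case: (odd n).
rewrite poly_gauss_int_hermite_rec1// IH// eqSS factS exprS natrM.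
by case: (m == n); ring.
Qed.

(** With the weight e^(-2 x^2), the recurrence H_(m+1) = 2 X H_m - H_m' accounts for
    only half of 4 X p - p', so both derivatives remain. *)
Lemma poly_gauss_int_hermite_rec2 m n : odd m != odd n ->
  poly_gauss_int 2 (H m.+1 * H n) =
  n%:R * poly_gauss_int 2 (H m * H n.-1) - m%:R * poly_gauss_int 2 (H m.-1 * H n).
Proof.
move=> mn; have := poly_gauss_int_parts (H m * H n) c2; rewrite hermite_polyM0//.
have -> : (2 * 2) *: ('X * (H m * H n)) - (H m * H n)^`() =
    2 *: (H m.+1 * H n - (n%:R *: (H m * H n.-1) - m%:R *: (H m.-1 * H n))).
  rewrite [H m.+1]hermite_polyS derivM !deriv_hermite_poly.
  by rewrite -!mul_polyC !polyCM !polyC_natr; ring.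
rewrite poly_gauss_intZ// !poly_gauss_intB// !poly_gauss_intZ// => /eqP.
by rewrite mulf_eq0 pnatr_eq0/= subr_eq0 => /eqP.
Qed.

Lemma Gamma_half : Gamma (0%:R + 1 / 2) = Num.sqrt pi :> R.
Proof. by rewrite Gamma_poly_gauss_int poly_gauss_int1// sqrtr1 divr1 mulrC divfK. Qed.

Lemma Gamma_halfS s : Gamma (s.+1%:R + 1 / 2) = (s%:R + 1 / 2) * Gamma (s%:R + 1 / 2) :> R.
Proof.
rewrite !Gamma_poly_gauss_int.
have := poly_gauss_int_parts ('X^((2 * s).+1) : {poly R}) c1.
rewrite hornerXn expr0n/=.
have -> : (2 * 1) *: ('X * 'X^((2 * s).+1)) - ('X^((2 * s).+1))^`() =
   2 *: 'X^(2 * s.+1) - (2 * s).+1%:R *: 'X^(2 * s) :> {poly R}.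
  by rewrite derivXn mulr1 !scaler_nat -exprS (_ : (2 * s.+1)%N = (2 * s).+2)//; lia.
rewrite poly_gauss_intB// !poly_gauss_intZ// => /eqP; rewrite subr_eq0 => /eqP ->.
by rewrite -natr1 natrM; field.
Qed.

(** Both terms of [poly_gauss_int_hermite_rec2] have index sum 2 s and opposite signs, so they
    combine with the factor m + n = 2 s + 1, twice the factor of the functional
    equation of Gamma at s + 1/2. The base of the induction is the Gaussian integral,
    and a first index 0 is avoided by symmetry. *)
Lemma poly_gauss_int_hermite_gauss s m n : (m + n)%N = (2 * s)%N ->
  poly_gauss_int 2 (H m * H n) =
  (-1) ^+ (s + m) * 2 ^+ s * Gamma (s%:R + 1 / 2) / (2 * Num.sqrt 2).
Proof.
elim: s m n => [|s IH] m n mns.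
  have [-> ->] : m = 0 /\ n = 0 by lia.
  rewrite Gamma_half mulr1 poly_gauss_int1// !expr0 !mul1r; field.
  by rewrite sqrtr_eq0 -ltNge.
(* If m = 0 then n > 0: the two indices are exchanged. *)
wlog [m' mE] : m n mns / exists m', m = m'.+1.
  move=> W; case: m mns => [|m] mns; last by apply: W => //; exists m.
  have nE : n = (2 * s.+1)%N by lia.
  rewrite mulrC W; [|lia|by exists (2 * s).+1; lia].
  congr (_ * _ * _ / _); rewrite nE !exprD mul2n -addnn exprD -expr2 sqrr_sign.
  by rewrite mulr1.
rewrite mE poly_gauss_int_hermite_rec2; last first.
  have : odd (m'.+1 + n) = false by rewrite -mE mns oddM.
  by rewrite oddD/=; case: (odd m'); case: (odd n).
pose V : R := 2 ^+ s * Gamma (s%:R + 1 / 2) / (2 * Num.sqrt 2).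
have E1 : n%:R * poly_gauss_int 2 (H m' * H n.-1) = n%:R * ((-1) ^+ (s + m') * V).
  case: n mns => [|n] mns; first by rewrite !mul0r.
  by rewrite /= IH ?/V; [ring|lia].
have E2 : m'%:R * poly_gauss_int 2 (H m'.-1 * H n) = - (m'%:R * ((-1) ^+ (s + m') * V)).
  case: m' mE {E1} => [|k] mE; first by rewrite !mul0r oppr0.
  rewrite /= IH ?/V; last by lia.
  by rewrite addnS exprS; ring.
rewrite E1 E2 Gamma_halfS.
have -> : (-1) ^+ (s.+1 + m'.+1) = (-1) ^+ (s + m') :> R.
  by rewrite addSn addnS !exprS; ring.
have -> : n%:R * ((-1) ^+ (s + m') * V) - - (m'%:R * ((-1) ^+ (s + m') * V)) =
   (n + m')%:R * ((-1) ^+ (s + m') * V) by rewrite natrD; ring.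
have -> : (n + m')%N = (2 * s).+1 by lia.
rewrite -natr1 natrM exprS /V; field.
by rewrite sqrtr_eq0 -ltNge.
Qed.

End Hermite.

(** * Functions with vanishing even moments *)

Section Threshold.
Variable R : realType.

Lemma bernoulli_ineq (u : R) n : -1 <= u -> 1 + n%:R * u <= (1 + u) ^+ n.
Proof.
move=> u1; elim: n => [|n IH]; first by rewrite mul0r addr0 expr0.
have u0 : 0 <= 1 + u by lra.
rewrite exprS; apply: le_trans (ler_wpM2l u0 IH).
have -> : (1 + u) * (1 + n%:R * u) = 1 + n.+1%:R * u + n%:R * u ^+ 2.
  by rewrite -natr1; ring.
by rewrite lerDl mulr_ge0 ?sqr_ge0.
Qed.

(** With r the square root of s, n r^n stays bounded by Bernoulli's inequality and the
    other factor r^n tends to 0. *)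
Lemma cvg_natmul_geometric (s : R) : 0 <= s < 1 -> n%:R * s ^+ n @[n --> \oo] --> (0 : R).
Proof.
move=> /andP[s0 s1]; pose r := Num.sqrt s.
have r0 : 0 <= r by exact: sqrtr_ge0.
have r1 : r < 1 by rewrite -sqrtr1 ltr_sqrt.
have bound n : n%:R * r ^+ n <= (1 - r)^-1.
  rewrite -[leRHS]mul1r ler_pdivlMr ?subr_gt0//.
  have [r00|rp] := leP r 0; first have -> : r = 0 by apply/eqP; rewrite eq_le r00.
    rewrite subr0 mulr1; case: n => [|n]; first by rewrite mul0r.
    by rewrite expr0n/= mulr0.
  have rV : 0 < r^-1 by rewrite invr_gt0.
  have := @bernoulli_ineq (r^-1 - 1) n.
  rewrite (_ : 1 + (r^-1 - 1) = r^-1) ?exprVn; last by ring.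
  have H : -1 <= r^-1 - 1 by lra.
  move=> /(_ H); rewrite -[(r ^+ n)^-1]mul1r ler_pdivlMr ?exprn_gt0//.
  apply: le_trans; rewrite mulrAC ler_wpM2r ?exprn_ge0//.
  have : 1 - r <= r^-1 - 1.
    rewrite -subr_ge0 (_ : _ - _ = (1 - r) ^+ 2 / r) ?divr_ge0 ?sqr_ge0//.
    by field; rewrite gt_eqF.
  by move=> /(ler_wpM2l (ler0n R n)); lra.
apply: (@squeeze_cvgr _ _ _ _ (fun=> 0) (fun n => (1 - r)^-1 * r ^+ n)).
- apply: nearW => n; rewrite mulr_ge0 ?exprn_ge0//=.
  rewrite -(sqr_sqrtr s0) -/r expr2 exprMn mulrA.
  by rewrite ler_wpM2r ?exprn_ge0.
- exact: cvg_cst.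
- by apply: (@cvg_geometric R (1 - r)^-1 r); rewrite ger0_norm.
Qed.

(** The order n b^(-n) makes m w^n tend to 0 for w < b, and at least n for w >= b: the
    extra factor n decides the case w = b. *)
Definition threshold_exponent (b : R) n := `|Num.ceil (n%:R / b ^+ n)|%N.

Lemma threshold_exponent_bounds b n : 0 < b ->
  n%:R / b ^+ n <= (threshold_exponent b n)%:R < n%:R / b ^+ n + 1.
Proof.
move=> b0; set y := n%:R / b ^+ n.
have y0 : 0 <= y by rewrite divr_ge0// exprn_ge0// ltW.
have -> : (threshold_exponent b n)%:R = (Num.ceil y)%:~R :> R.
  rewrite /threshold_exponent -/y natr_absz ger0_norm//.
  by rewrite ceil_ge0// (lt_le_trans _ y0)// ltrN10.
by have := ceil_itv y; rewrite intrD mulrN1z ltrBlDr andbC.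
Qed.

Lemma threshold_itv (w b : R) n : 0 <= w <= 1 ->
  0 <= (1 - w ^+ n) ^+ threshold_exponent b n <= 1.
Proof.
move=> /andP[w0 w1]; have wn1 : w ^+ n <= 1 by rewrite exprn_ile1.
have wn0 : 0 <= w ^+ n by rewrite exprn_ge0.
by rewrite exprn_ge0 ?subr_ge0//= exprn_ile1 ?subr_ge0// gerBl.
Qed.

(** Below b, Bernoulli's inequality gives (1 - w^n)^m >= 1 - m w^n. Above b,
    (1 - w^n)^m <= 1 / (1 + w^n)^m <= 1 / (1 + m w^n). *)
Lemma cvg_threshold (w b : R) : 0 < w < 1 -> 0 < b ->
  (1 - w ^+ n) ^+ threshold_exponent b n @[n --> \oo] --> ((w < b)%R%:R : R).
Proof.
move=> /andP[w0 w1] b0.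
have wi n : 0 <= w ^+ n by rewrite exprn_ge0// ltW.
have wn1 n : w ^+ n <= 1 by rewrite exprn_ile1 ?ltW.
have ti n : 0 <= (1 - w ^+ n) ^+ threshold_exponent b n <= 1.
  by apply: threshold_itv; rewrite !ltW.
have [wb|bw] := ltP w b.
- apply: (@squeeze_cvgr _ _ _ _ (fun n => 1 - (n%:R * (w / b) ^+ n + w ^+ n)) (fun=> 1)).
  + apply: nearW => n; have /andP[_ ->] := ti n.
    rewrite andbT; have := @bernoulli_ineq (- w ^+ n) (threshold_exponent b n).
    rewrite lerN2 wn1 => /(_ isT); apply: le_trans.
    rewrite mulrN lerD2l lerN2 exprMn exprVn mulrA mulrAC -[X in _ <= _ + X]mul1r -mulrDl.
    by rewrite ler_wpM2r//; have /andP[_ /ltW] := threshold_exponent_bounds n b0.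
  + rewrite -[X in _ --> X]subr0 -[X in _ --> _ - X](addr0 0).
    apply: cvgB; first exact: cvg_cst.
    apply: cvgD.
      apply: cvg_natmul_geometric; rewrite divr_ge0 ?ltW//=.
      by rewrite ltr_pdivrMr// mul1r.
    by apply: cvg_expr; rewrite ger0_norm// ltW.
  + exact: cvg_cst.
- apply: (@squeeze_cvgr _ _ _ _ (fun=> 0) (fun n => n.+1%:R^-1)).
  + apply: nearW => n; have /andP[-> _]/= := ti n.
    set m := threshold_exponent b n.
    have nm : n%:R <= m%:R * w ^+ n.
      have /andP[H _] := threshold_exponent_bounds n b0.
      apply: le_trans (ler_wpM2r (wi n) H).
      rewrite mulrAC -mulrA -expr_div_n ler_peMr// exprn_ege1//.
      by rewrite ler_pdivlMr// mul1r.
    rewrite -[leRHS]mul1r ler_pdivlMr ?ltr0n//.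
    have B : 1 + m%:R * w ^+ n <= (1 + w ^+ n) ^+ m.
      by apply: bernoulli_ineq; apply: le_trans (wi n); rewrite lerN10.
    have c0 : 0 <= (1 - w ^+ n) ^+ m by rewrite exprn_ge0// subr_ge0.
    apply: (@le_trans _ _ ((1 - w ^+ n) ^+ m * (1 + w ^+ n) ^+ m)).
      by rewrite ler_wpM2l// (le_trans _ B)// -natr1 addrC lerD2l.
    rewrite -exprMn -subr_sqr expr1n; apply: exprn_ile1.
      by rewrite subr_ge0; exact: exprn_ile1.
    by rewrite gerBl sqr_ge0.
  + exact: cvg_cst.
  + exact: cvg_harmonic.
Qed.

End Threshold.

Section MomentUniqueness.
Variable R : realType.
Local Notation D := (`]0, +oo[%classic : set R).
Variable mu : {measure set (measurableTypeR R) -> \bar R}.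

Definition null_integral (f : R -> R) :=
  mu.-integrable D (EFin \o f) /\ (\int[mu]_(x in D) (f x)%:E = 0)%E.

Let mD : measurable (D : set (measurableTypeR R)).
Proof. exact: measurable_itv. Qed.

Lemma null_integral_lin a f g : null_integral f -> null_integral g ->
  null_integral (fun x => a * f x + g x).
Proof.
move=> [fi f0] [gi g0].
have afi : mu.-integrable D (fun x => a%:E * (f x)%:E)%E by exact: integrableZl.
split.
  rewrite (_ : _ \o _ = (fun x => a%:E * (f x)%:E) \+ (EFin \o g))%E//.
  exact: integrableD.
transitivity (\int[mu]_(x in D) (a%:E * (f x)%:E + (g x)%:E))%E => //.
by rewrite integralD//= g0 integralZl// f0 mule0 adde0.
Qed.

(** Multiplying G by a power of v first makes the induction on the polynomial go
    through. *)
Lemma null_integral_poly (G v : R -> R) :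
  (forall k, null_integral (fun x => G x * v x ^+ k)) ->
  forall p : {poly R}, null_integral (fun x => G x * p.[v x]).
Proof.
move=> Gv p.
have : forall k, null_integral (fun x => G x * v x ^+ k * p.[v x]).
  elim/poly_ind: p => [|p c IH] k.
    have := null_integral_lin (-1) (Gv k) (Gv k).
    by congr null_integral; apply/funext => x; rewrite horner0; ring.
  have := null_integral_lin c (Gv k) (IH k.+1).
  by congr null_integral; apply/funext => x; rewrite hornerMXaddC exprS; ring.
by move=> /(_ 0); under eq_fun do rewrite mulr1.
Qed.

Lemma null_integral_limit (f_ : nat -> R -> R) (f g : R -> R) :
  (forall n, null_integral (f_ n)) -> measurable_fun D f ->
  mu.-integrable D (EFin \o g) ->
  (forall x, D x -> f_ ^~ x @ \oo --> f x) ->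
  (forall n x, D x -> `|f_ n x| <= g x) -> null_integral f.
Proof.
move=> f_0 mf gi f_f f_g.
have mf_ n : measurable_fun D (EFin \o f_ n) by exact: measurable_int (f_0 n).1.
have [||//|fi _ lim] := @dominated_convergence _ _ R mu D mD (fun n => EFin \o f_ n)
  (EFin \o f) (EFin \o g) mf_ _ _ gi.
- exact/measurable_EFinP.
- by apply: aeW => x Dx; apply: cvg_EFin; [exact: nearW|exact: f_f].
- by apply: aeW => x n Dx; rewrite lee_fin f_g.
split => //; apply/esym; apply: cvg_unique lim => //.
by rewrite (_ : [sequence _]_n = cst 0%E); [exact: cvg_cst|apply/funext => n; exact: (f_0 n).2].
Qed.

Variable g : R -> R.
Hypothesis mg : measurable_fun D g.
Hypothesis gi : forall k,
  mu.-integrable D (EFin \o (fun x => g x * x ^+ (2 * k) * gauss (- (1 / 4)) x)).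
Hypothesis g0 : forall k, \int[mu]_(x in D) (g x * x ^+ (2 * k)) = 0.

Let w (x : R) := gauss (1 / 4) x.

Let w_itv x : D x -> 0 < w x < 1.
Proof.
rewrite /= in_itv/= andbT => x0; rewrite /w /gauss expR_gt0/= -expR0 ltr_expR.
by rewrite oppr_lt0 mulr_gt0// exprn_gt0.
Qed.

Let mw : measurable_fun D w. Proof. exact: measurable_gauss. Qed.

Let dominated_moment (u : R -> R) k : measurable_fun D u ->
  (forall x, D x -> `|u x| <= gauss (- (1 / 4)) x) ->
  mu.-integrable D (EFin \o (fun x => g x * x ^+ (2 * k) * u x)).
Proof.
move=> mu_ ub.
apply: (le_mul_integrable mD _ _ (integrable_norm (gi k))) => //.
  by apply: measurable_funM => //; apply: measurable_funM => //; exact: measurable_funX.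
move=> x Dx; rewrite /= normrM [leRHS]normrM ler_wpM2l//.
by rewrite [leRHS]ger0_norm ?gauss_ge0// ub.
Qed.

(** One more factor w = e^(-x^2/4) is the limit of polynomials in x^2, the partial sums of
    its power series, all bounded by e^(x^2/4). *)
Lemma null_integral_moments j k : null_integral (fun x => g x * x ^+ (2 * k) * w x ^+ j).
Proof.
elim: j k => [|j IH] k.
  have i1 : mu.-integrable D (EFin \o (fun x => g x * x ^+ (2 * k) * 1)).
    apply: (@dominated_moment (fun=> 1)) => // x _.
    rewrite normr1 /gauss -expR0 ler_expR.
    by rewrite mulNr opprK mulr_ge0 ?sqr_ge0.
  under eq_fun do rewrite expr0.
  split => //; under eq_integral do rewrite mulr1.
  rewrite -[LHS]fineK; first by congr EFin; exact: g0.
  have := integrable_fin_num mD i1; congr (_ \is a fin_num).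
  by apply: eq_integral => x _; rewrite /= mulr1.
pose q n : {poly R} := \poly_(i < n) ((- (1 / 4)) ^+ i / i`!%:R).
have qE n x : (q n).[x ^+ 2] = series (exp_coeff (- (1 / 4) * x ^+ 2)) n.
  rewrite horner_poly /series/= big_mkord; apply: eq_bigr => i _.
  by rewrite exp_coeffE [in RHS]exprMn mulrAC [LHS]mulrC.
have qw x : (q n).[x ^+ 2] @[n --> \oo] --> w x.
  under eq_fun do rewrite qE.
  by rewrite /w /gauss -mulNr; exact: is_cvg_series_exp_coeff.
have q_le n x : `|(q n).[x ^+ 2]| <= gauss (- (1 / 4)) x.
  rewrite qE; apply: le_trans (ler_norm_sum _ _ _) _.
  have -> : \sum_(0 <= i < n) `|exp_coeff (- (1 / 4) * x ^+ 2) i| =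
      series (exp_coeff `|- (1 / 4) * x ^+ 2|) n.
    by rewrite -normed_series_exp_coeff.
  rewrite /gauss (_ : - (- (1 / 4) * x ^+ 2) = `|- (1 / 4) * x ^+ 2|); last first.
    by rewrite mulNr normrN opprK ger0_norm// mulr_ge0 ?sqr_ge0.
  apply: nondecreasing_cvgn_le; last exact: is_cvg_series_exp_coeff.
  by apply: nondecreasing_series => i _ _; apply: exp_coeff_ge0.
apply: (@null_integral_limit (fun n x => g x * x ^+ (2 * k) * w x ^+ j * (q n).[x ^+ 2])
   _ (fun x => `|g x * x ^+ (2 * k) * gauss (- (1 / 4)) x|)).
- move=> n; apply: (@null_integral_poly (fun x => g x * x ^+ (2 * k) * w x ^+ j) (fun x => x ^+ 2)).
  move=> i; have := IH (k + i)%N; congr null_integral; apply/funext => x.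
  by rewrite mulnDr exprD [x ^+ (2 * i)]exprM; ring.
- apply: measurable_funM; last exact: measurable_funX.
  by apply: measurable_funM => //; exact: measurable_funX.
- exact: integrable_norm (gi k).
- move=> x Dx; rewrite /= [w x ^+ j.+1]exprSr mulrA; apply: cvgM; [exact: cvg_cst|exact: qw].
- move=> n x Dx; rewrite -mulrA normrM [leRHS]normrM ler_wpM2l// normrM.
  rewrite [leRHS]ger0_norm ?gauss_ge0// -[leRHS]mul1r ler_pM// normrX.
  have /andP[w0 w1] := w_itv Dx.
  by rewrite exprn_ile1// ger0_norm ltW.
Qed.

(** As w decreases in x, the ray x > a is the set w(x) < w(a), whose indicator is a
    bounded limit of polynomials in w. *)
Lemma null_integral_ray a : null_integral (fun x => g x * (a < x)%R%:R).
Proof.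
have base (p : {poly R}) : null_integral (fun x => g x * p.[w x]).
  apply: null_integral_poly => k; have := null_integral_moments k 0.
  by under eq_fun do rewrite muln0 mulr1.
have [a0|a0] := leP a 0.
  have [fi f0] := base 1; split.
    apply: eq_integrable fi => // x; rewrite inE/= in_itv/= andbT => x0.
    by rewrite hornerC (le_lt_trans a0 x0).
  rewrite -f0; apply: eq_integral => x; rewrite inE/= in_itv/= andbT => x0.
  by rewrite hornerC (le_lt_trans a0 x0).
apply: (@null_integral_limit
  (fun n x => g x * (1 - w x ^+ n) ^+ threshold_exponent (w a) n) _ (fun x => `|g x|)).
- move=> n; have := base ((1 - 'X^n) ^+ threshold_exponent (w a) n).
  by congr null_integral; apply/funext => x; rewrite horner_exp !hornerE.
- apply: measurable_funM => //.
  apply: (@eq_measurable_fun _ _ _ _ D (\1_(`]a, +oo[%classic : set R) : R -> R)).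
    move=> x _; rewrite indicE (_ : (x \in _) = (a < x)%R)//.
    by apply/idP/idP; rewrite inE/= in_itv/= andbT.
  by apply: measurable_funTS; exact: measurable_indic.
- have := integrable_norm (base 1).1; apply: eq_integrable => // x _ /=.
  by rewrite hornerC mulr1.
- move=> x Dx; apply: cvgM; first exact: cvg_cst.
  have -> : (a < x)%R = (w x < w a)%R.
    rewrite /w /gauss ltr_expR ltrN2 ltr_pM2l//.
    by move: Dx; rewrite /= in_itv/= andbT => x0; rewrite ltr_pXn2r// ?nnegrE ltW.
  by apply: cvg_threshold; [exact: w_itv|exact: expR_gt0].
- move=> n x Dx; rewrite normrM ler_piMr//.
  have /andP[w0 w1] := w_itv Dx.
  have w01 : 0 <= w x <= 1 by rewrite !ltW.
  have /andP[t0 t1] := threshold_itv (w a) n w01.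
  by rewrite ger0_norm.
Qed.

(** Rays generate the Borel sets and are stable under intersection, so the integral of
    g vanishes over every Borel set. *)
Lemma even_moments_zero : {ae mu, forall x, D x -> g x = 0}.
Proof.
have gint : mu.-integrable D (EFin \o g).
  have := (null_integral_ray 0).1; apply: eq_integrable => // x.
  by rewrite inE/= in_itv/= andbT => ->; rewrite mulr1.
have gT : (\int[mu]_(x in D) (g x)%:E = 0)%E.
  rewrite -(null_integral_ray 0).2; apply: eq_integral => x.
  by rewrite inE/= in_itv/= andbT => ->; rewrite mulr1.
have key A : measurable A -> (\int[mu]_(x in D `&` A) (g x)%:E = 0)%E.
  move=> mA; have : (<<s (@RGenOInfty.G R) >>) A.
    by suff: (@ocitv R).-sigma.-measurable A by rewrite RGenOInfty.measurableE.
  move: A {mA}; apply: (@dynkin_induction _ (measurableTypeR R)).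
  - exact: RGenOInfty.measurableE.
  - move=> _ _ [a ->] [b ->]; exists (Num.max a b).
    by apply/seteqP; split => x; rewrite /= !in_itv/= !andbT gt_max => /andP.
  - by rewrite setIT.
  - move=> _ [a ->]; rewrite -(null_integral_ray a).2 integral_mkcondr.
    apply: eq_integral => x _; rewrite patchE /=.
    by case: ifPn; rewrite ?inE ?notin_setE/= in_itv/= andbT => ax;
      [rewrite ax mulr1|move/negP/negbTE : ax => ->; rewrite mulr0].
  - move=> S mS PS; have DE : D = (D `&` S) `|` (D `&` ~` S) by rewrite -setIUr setUv setIT.
    have := gT; rewrite {1}DE integral_setU ?PS ?add0e//.
    + exact: measurableI.
    + by apply: measurableI => //; exact: measurableC.
    + by rewrite -DE; exact: measurable_int gint.
    + by apply/disj_setPS => x [[_ ?] [_]].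
  - move=> F mF tF PF; rewrite setI_bigcupr integral_bigcup//.
    + by rewrite eseries0.
    + exact: trivIset_setIl.
    + by move=> n; exact: measurableI.
    + apply: integrableS gint => //.
      * by apply: bigcup_measurable => n _; exact: measurableI.
      * by move=> x [n _ []].
have := @integral_ae_eq _ _ R mu D mD (cst 0%E) (EFin \o g) gint (measurable_cst _).
move=> /(_ _)-H; have {}H := H _; apply: filterS (H _) => [x /[apply] /= -[]//|E ED mE].
by rewrite integral0 -[RHS](key E mE) setIidr.
Qed.

End MomentUniqueness.

(** * The even and odd Hermite bases *)

Section ParityBasis.
Variables (R : realType) (b : nat).
Hypothesis b1 : (b <= 1)%N.
Local Notation D := (`]0, +oo[%classic : set R).
Local Notation mu := (@mu_half R).
Local Notation sqint := (sqint mu D).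
Local Notation ip := (ip mu D).
Local Notation H := (hermite_poly R).

Let mD : measurable (D : set (measurableTypeR R)).
Proof. exact: measurable_itv. Qed.

(** The even (b = 0) or odd (b = 1) family. *)
Definition parity_basis m (x : R) := Num.sqrt 2 * hermite_normalized (2 * m + b) x.

Definition parity_coef m : R :=
  Num.sqrt 2 / Num.sqrt (2 ^+ (2 * m + b) * (2 * m + b)`!%:R).

(** [H3e] for b = 0 and [H3o] for b = 1. *)
Definition parity_matrix m n : R :=
  (-1) ^+ (m + n) * Gamma ((m + n + b)%:R + 1 / 2) /
  Num.sqrt ((2 * m + b)`!%:R * (2 * n + b)`!%:R).

Lemma parity_basisE m x : parity_basis m x = parity_coef m * (H (2 * m + b)).[x].
Proof. by rewrite /parity_basis /hermite_normalized hermiteE mulrA. Qed.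

Lemma parity_basis_fun m : parity_basis m = fun x => parity_coef m * (H (2 * m + b)).[x].
Proof. by apply/funext => x; exact: parity_basisE. Qed.

Lemma parity_coef_neq0 m : parity_coef m != 0.
Proof.
by rewrite mulf_neq0// ?invr_eq0 gt_eqF// sqrtr_gt0// mulr_gt0 ?exprn_gt0// ltr0n fact_gt0.
Qed.

Lemma parity_coefM m n : parity_coef m * parity_coef n =
  2 / (2 ^+ (m + n + b) * Num.sqrt ((2 * m + b)`!%:R * (2 * n + b)`!%:R)).
Proof.
have f0 k : 0 <= k`!%:R :> R by [].
rewrite /parity_coef mulrACA -expr2 sqr_sqrtr// -invfM -sqrtrM ?mulr_ge0 ?exprn_ge0//.
rewrite mulrACA -exprD (_ : (2 * m + b + (2 * n + b))%N = ((m + n + b) * 2)%N); last by lia.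
by rewrite exprM [in LHS]sqrtrM ?sqr_ge0// sqrtr_sqr ger0_norm// exprn_ge0.
Qed.

Lemma sqint_poly_gauss (p : {poly R}) c : c < 1 / 2 -> sqint (fun x => p.[x] * gauss (- c) x).
Proof.
move=> c1; split; first exact: measurable_gauss_poly.
have c2 : c + c < 1 by lra.
have := integrable_mu_half_poly (p * p) c2; apply: eq_integrable => // x _ /=.
by rewrite hornerM opprD gaussD; congr EFin; ring.
Qed.

Lemma gauss0 (x : R) : gauss 0 x = 1.
Proof. by rewrite /gauss mul0r oppr0 expR0. Qed.

Lemma sqint_poly (p : {poly R}) : sqint (fun x => p.[x]).
Proof.
have := @sqint_poly_gauss p 0; rewrite divr_gt0// => /(_ isT).
by congr sqint; apply/funext => x; rewrite oppr0 gauss0 mulr1.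
Qed.

Lemma ip_poly (p q : {poly R}) :
  ip (fun x => p.[x]) (fun x => q.[x]) = (Num.sqrt pi)^-1 * poly_gauss_int 1 (p * q).
Proof.
have := @Rintegral_mu_half_gauss R (p * q) 0; rewrite ltrN10 => /(_ isT).
rewrite addr0 => <-; apply: eq_Rintegral => x _.
by rewrite gauss0 mulr1 hornerM.
Qed.

Lemma sqint_parity_basis m : sqint (parity_basis m).
Proof.
rewrite parity_basis_fun.
by apply: sqintZ => //; exact: sqint_poly.
Qed.

Lemma odd_parity m : odd (2 * m + b) = odd b.
Proof. by rewrite oddD oddM. Qed.

Let sqrtpi_neq0 : Num.sqrt pi != 0 :> R.
Proof. by rewrite gt_eqF// sqrtr_gt0 pi_gt0. Qed.

Let sqrt_neq0 m n : Num.sqrt ((2 * m + b)`!%:R * (2 * n + b)`!%:R) != 0 :> R.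
Proof. by rewrite gt_eqF// sqrtr_gt0 mulr_gt0 // ltr0n fact_gt0. Qed.

Lemma parity_basis_orthonormal m n : ip (parity_basis m) (parity_basis n) = (m == n)%:R.
Proof.
transitivity (parity_coef m * parity_coef n *
    ip (fun x => (H (2 * m + b)).[x]) (fun x => (H (2 * n + b)).[x])).
  have sH k := sqint_poly (H k).
  rewrite !parity_basis_fun ipZ//; last exact: sqintZ.
  by rewrite ipC ipZ// ipC mulrA.
rewrite ip_poly poly_gauss_int_hermite_orthogonal; last by rewrite !odd_parity.
rewrite eqn_add2r eqn_mul2l/= parity_coefM.
have [->|] := eqVneq m n; last by rewrite !mul0r !mulr0.
rewrite (_ : n + n + b = 2 * n + b)%N; last by lia.
rewrite -expr2 sqrtr_sqr ger0_norm//; field.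
by rewrite sqrtpi_neq0 expf_neq0//= pnatr_eq0 -lt0n fact_gt0.
Qed.

Lemma parity_matrixE m n :
  parity_matrix m n = ip (fun x => h_fun x * parity_basis m x) (parity_basis n).
Proof.
pose p := parity_coef m * parity_coef n *: (H (2 * m + b) * H (2 * n + b)).
have pe : ip (fun x => h_fun x * parity_basis m x) (parity_basis n) =
    Num.sqrt (2 * pi) * \int[mu]_(x in D) (p.[x] * gauss 1 x).
  have i1 : mu.-integrable D (EFin \o (fun x => p.[x] * gauss 1 x)).
    have := @integrable_mu_half_poly R p (-1); rewrite opprK; apply.
    by rewrite (lt_trans (ltrN10 R)).
  rewrite -RintegralZl//; apply: eq_Rintegral => x _.
  by rewrite /h_fun !parity_basisE /p hornerZ hornerM /gauss mul1r; ring.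
rewrite pe Rintegral_mu_half_gauss; last by rewrite (lt_trans (ltrN10 R)).
rewrite poly_gauss_intZ// (@poly_gauss_int_hermite_gauss _ (m + n + b)); last by lia.
rewrite parity_coefM /parity_matrix [Num.sqrt (2 * pi)]sqrtrM//.
have -> : (-1) ^+ (m + n + b + (2 * m + b)) = (-1) ^+ (m + n) :> R.
  rewrite (_ : (m + n + b + (2 * m + b))%N = (m + n + (m + b) * 2)%N); last by lia.
  by rewrite exprD exprM sqrr_sign mulr1.
field; rewrite sqrtpi_neq0 sqrt_neq0 expf_neq0//=.
by rewrite gt_eqF// sqrtr_gt0.
Qed.

(** Multiplication by X^2 stays within Hermite polynomials of one parity. *)
Lemma hermite_poly_X2 n : 4 *: ('X^2 * H n) =
  H n.+2 + (2 * (2 * n%:R + 1)) *: H n + (2 * (2 * (n%:R * n.-1%:R))) *: H n.-2 :> {poly R}.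
Proof.
have rec k : H k.+1 = 2 *: ('X * H k) - (2 * k%:R) *: H k.-1.
  by rewrite hermite_polyS deriv_hermite_poly.
rewrite (rec n.+1) (rec n)/=.
case: n => [|n]; first by rewrite /hermite_poly/= -!mul_polyC !polyCM ?polyCD !polyC_natr; ring.
have := rec n; rewrite /= => E.
have -> : (2 * (2 * (n.+1%:R * n%:R))) *: H n.-1 =
   (2 * n.+1%:R) *: (2 *: ('X * H n) - H n.+1).
  by rewrite E -!mul_polyC !polyCM !polyC_natr; ring.
rewrite -!mul_polyC !polyCM ?polyCD !polyCM !polyC_natr.
by ring.
Qed.

Section Completeness.
Variable f : R -> R.
Hypothesis sf : sqint f.
Hypothesis f0 : forall m, ip f (parity_basis m) = 0.

Let sp := sqint_poly.

Lemma ip_hermite0 m : ip f (fun x => (H (2 * m + b)).[x]) = 0.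
Proof.
have := f0 m.
rewrite parity_basis_fun ipC ipZ// ipC => /eqP; rewrite mulf_eq0 (negbTE (parity_coef_neq0 m))/=.
by move=> /eqP.
Qed.

(** By [hermite_poly_X2], orthogonality to the whole family is preserved when it is
    multiplied by X^2. *)
Lemma ip_X2_hermite0 k m : ip f (fun x => ('X^(2 * k) * H (2 * m + b)).[x]) = 0.
Proof.
elim: k m => [|k IH] m; first by under [X in ip f X]eq_fun do rewrite mul1r; exact: ip_hermite0.
pose q j : {poly R} := 'X^(2 * k) * H j.
(* H_(n-2) leaves the family when m = 0, but then n (n - 1) = 0. *)
have IH2 : ((2 * m + b)%:R * (2 * m + b).-1%:R) * ip f (fun x => (q (2 * m + b).-2).[x]) = 0.
  case: m => [|m].
    by case: (b) b1 => [|[|//]] _; rewrite !(mul0r, mulr0).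
  rewrite (_ : (2 * m.+1 + b).-2 = 2 * m + b)%N; last by lia.
  by rewrite IH mulr0.
pose n := (2 * m + b)%N; rewrite -/n in IH2 *.
have IHS : ip f (fun x => (q n.+2).[x]) = 0.
  by rewrite /q (_ : n.+2 = 2 * m.+1 + b)%N ?IH// /n; lia.
have : ip f (fun x => (4 : R) * ('X^(2 * k.+1) * H n).[x]) = 0.
  have -> : (fun x => (4 : R) * ('X^(2 * k.+1) * H n).[x]) =
    (fun x => 1 * (q n.+2).[x] + ((2 * (2 * n%:R + 1)) * (q n).[x] +
        (2 * (2 * (n%:R * n.-1%:R))) * (q n.-2).[x])).
    apply/funext => x; rewrite -!hornerZ -!hornerD; congr (_.[x]).
    rewrite scale1r /q !scalerAr -!mulrDr addrA -hermite_poly_X2.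
    by rewrite mulnS exprD -!mul_polyC; ring.
  have sZ c j : sqint (fun x => c * (q j).[x]) by apply: sqintZ => //; exact: sqint_poly.
  have sq j := sqint_poly (q j).
  rewrite ip_lin_r//; last exact: sqint_lin.
  rewrite ip_lin_r// IHS IH ipC ipZ// ipC.
  by rewrite -!mulrA [X in 2 * (2 * X)]mulrA IH2 !mulr0 !addr0.
rewrite ipC ipZ// ipC => /eqP; rewrite mulf_eq0 pnatr_eq0/= => /eqP.
by [].
Qed.

(** H_b is 1 or 2 X, so it has no zero on the open half line, and f H_b has vanishing
    even moments. *)
Lemma parity_basis_total : {ae mu, forall x, D x -> f x = 0}.
Proof.
pose g x := f x * (H b).[x].
have Hb x : D x -> (H b).[x] != 0.
  rewrite /= in_itv/= andbT => x0; case: (b) b1 => [|[|//]] _; rewrite /hermite_poly/=.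
    by rewrite hornerC oner_neq0.
  by rewrite hornerZ hornerX mulf_neq0// gt_eqF.
have mg : measurable_fun D g by apply: measurable_funM; [exact: sf.1|exact: (sp _).1].
have := @even_moments_zero R mu g mg.
move=> /(_ _)/(_ _)H0.
have : {ae mu, forall x, D x -> g x = 0}.
  apply: H0 => k.
    have := sqint_mulI mD sf (@sqint_poly_gauss ('X^(2 * k) * H b) (1 / 4) _).
    have c4 : 1 / 4 < 1 / 2 :> R by lra.
    move=> /(_ c4); apply: eq_integrable => // x _ /=.
    by rewrite /g hornerM hornerXn; congr EFin; ring.
  rewrite -[RHS](ip_X2_hermite0 k 0); apply: eq_Rintegral => x _.
  by rewrite /g muln0 add0n hornerM hornerXn; ring.
apply: (@filterS _ _ (ae_filter_ringOfSetsType mu)) => x gx0 Dx; have /eqP := gx0 Dx.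
by rewrite mulf_eq0 (negbTE (Hb _ Dx)) orbF => /eqP.
Qed.

End Completeness.

Theorem parity_diagonalization :
  determines_unique_selfadjoint parity_matrix /\
  exists U : (nat -> R[i]) -> (R -> R[i]),
    [/\ unitary_ell2_L2 mu D U,
        forall n, L2_eq mu D (U (ebasis R n))
          (fun x => (Num.sqrt 2 * hermite_normalized (2 * n + b) x)%:C) &
        conj_operator mu D U (A_max parity_matrix) = mult_operator mu D (@h_fun R)].
Proof.
apply: (@diagonalization _ _ _ mu D mD parity_basis sqint_parity_basis
  parity_basis_orthonormal parity_basis_total (@h_fun R) (Num.sqrt (2 * pi))).
- apply: measurable_funM => //; apply: measurable_funTS; exact: measurable_gauss_fun.
- exact: sqrtr_ge0.
- move=> x _; rewrite /h_fun normrM ger0_norm ?sqrtr_ge0// ler_piMr ?sqrtr_ge0//.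
  by rewrite ger0_norm ?expR_ge0// -expR0 ler_expR oppr_le0 sqr_ge0.
- exact: parity_matrixE.
Qed.

End ParityBasis.

Theorem corollary6 (R : realType) :
  (determines_unique_selfadjoint (@H3e R) /\
   exists Ue : (nat -> R[i]) -> (R -> R[i]),
     [/\ unitary_ell2_L2 (@mu_half R) `]0, +oo[ Ue,
         forall n : nat, L2_eq (@mu_half R) `]0, +oo[ (Ue (ebasis R n))
           (fun x => (Num.sqrt 2 * hermite_normalized (2 * n) x)%:C) &
         conj_operator (@mu_half R) `]0, +oo[ Ue (A_max (@H3e R))
         = mult_operator (@mu_half R) `]0, +oo[ (@h_fun R)])
  /\
  (determines_unique_selfadjoint (@H3o R) /\
   exists Uo : (nat -> R[i]) -> (R -> R[i]),
     [/\ unitary_ell2_L2 (@mu_half R) `]0, +oo[ Uo,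
         forall n : nat, L2_eq (@mu_half R) `]0, +oo[ (Uo (ebasis R n))
           (fun x => (Num.sqrt 2 * hermite_normalized (2 * n + 1) x)%:C) &
         conj_operator (@mu_half R) `]0, +oo[ Uo (A_max (@H3o R))
         = mult_operator (@mu_half R) `]0, +oo[ (@h_fun R)]).
Proof.
have -> : @H3e R = @parity_matrix R 0.
  by apply/funext => m; apply/funext => n; rewrite /parity_matrix !addn0.
have -> : @H3o R = @parity_matrix R 1.
  apply/funext => m; apply/funext => n; rewrite /parity_matrix /H3o.
  by congr (_ * Gamma _ / _); rewrite natrD; lra.
split; last exact: parity_diagonalization.
have [dm [U [uU Ue Ud]]] := @parity_diagonalization R 0 isT.
split => //; exists U; split => // n.
by have := Ue n; rewrite addn0.
Qed.
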